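(* Let $G=(V,E)$ be a finite connected bipartite (multi)graph. Then for every $z>0$, \[ \ln P_G(z) \geq \max_{\mathbf{x} \in M(G)} \Big\{\Big( \sum_{e\in E} x_e\Big)\ln z+S^B_G(\mathbf{x})\Big\}. \] Moreover, for every integer $0\le k\leq \nu(G)$, \[ m_k(G) \geq b_{\nu(G),k}\big(k/\nu(G)\big)\exp \Big( \max_{\mathbf{x} \in M_k(G)} S^B_G(\mathbf{x})\Big), \] where $b_{n,k}(p) = \binom{n}{k}p^k(1-p)^{n-k}$. Finally, there exists a sequence of bipartite graphs $(G_n=(V_n,E_n))_{n\in \mathbb{N}}$ such that $G_0=G$, $G_n$ is a $2$-lift of $G_{n-1}$ for every $n\geq 1$, and for all $z>0$, \[ \lim_{n\to \infty} \frac{1}{v(G_n)} \ln P_{G_n}(z) = \frac{1}{v(G)}\max_{\mathbf{x} \in M(G)} \Big\{\Big( \sum_{e\in E} x_e\Big)\ln z+S^B_G(\mathbf{x})\Big\}. \]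
   Context: For a graph $G=(V,E)$, $v(G)=|V|$. A matching is a set of pairwise vertex-disjoint edges; it is identified with its incidence vector $\mathbf{B}\in\{0,1\}^E$; its size is the number of edges. $m_k(G)$ is the number of matchings of size $k$ ($m_0(G)=1$), $\nu(G)$ is the maximum size of a matching, and $P_G(z)=\sum_{k=0}^{\nu(G)} m_k(G)z^k$. For a vertex $v$, $\partial v$ denotes the set of edges incident to $v$. $M(G)$ is the convex hull of incidence vectors of matchings of $G$, and $M_k(G)$ is the convex hull of incidence vectors of matchings of size $k$. For $\mathbf{x}\in M(G)$, \[ S^B_G(\mathbf{x})=\sum_{e\in E}\big( -x_e\ln x_e +(1-x_e)\ln (1-x_e)\big) - \sum_{v\in V}\Big( 1-\sum_{e\in \partial v} x_e\Big)\ln\Big( 1-\sum_{e\in \partial v}x_e\Big), \] with the convention $0\ln 0=0$. A $2$-lift of a loopless graph $G$ is a graph $H$ with $V(H)=V(G)\times\{0,1\}$ such that for every edge $(u,v)$ of $G$ exactly one of the following two pairs of edges is in $H$: $\{((u,0),(v,0)),((u,1),(v,1))\}$ or $\{((u,0),(v,1)),((u,1),(v,0))\}$, and $H$ has no other edges. *)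

(* Defs.v *)
From HB Require Import structures.
From mathcomp Require Import all_boot all_order all_algebra.
From mathcomp Require Import all_classical all_reals all_analysis.
Set Implicit Arguments. Unset Strict Implicit. Unset Printing Implicit Defensive.
Import Order.TTheory GRing.Theory Num.Theory.
Local Open Scope ring_scope.

(* A finite multigraph: finite vertex type, finite edge type, and each edge
   has two endpoints (orientation irrelevant; loops excluded by bipartiteness). *)
Record mgraph := MGraph {
  gV : finType;
  gE : finType;
  gends : gE -> gV * gV }.

Section Graphs.
Variable G : mgraph.

Definition incident (v : gV G) (e : gE G) : bool :=
  ((gends e).1 == v) || ((gends e).2 == v).

Definition adj : rel (gV G) :=
  fun u v => [exists e, (gends e == (u, v)) || (gends e == (v, u))].

Definition connected_graph : Prop := forall u v : gV G, connect adj u v.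

Definition bipartite : Prop :=
  exists c : gV G -> bool, forall e : gE G, c (gends e).1 != c (gends e).2.

Definition nverts : nat := #|gV G|.

Definition is_matching (B : {set gE G}) : bool :=
  [forall v : gV G, #|[set e in B | incident v e]| <= 1]%N.

Definition mcount (k : nat) : nat :=
  #|[set B : {set gE G} | is_matching B && (#|B| == k)]|.

Definition nu : nat := (\max_(B : {set gE G} | is_matching B) #|B|)%N.

Variable R : realType.

Definition matching_poly (z : R) : R :=
  \sum_(k < nu.+1) (mcount k)%:R * z ^+ k.

Definition incvec (B : {set gE G}) : gE G -> R := fun e => (e \in B)%:R.

Definition in_hull (P : {set gE G} -> bool) (x : gE G -> R) : Prop :=
  exists lam : {set gE G} -> R,
    [/\ forall B, 0 <= lam B,
        forall B, ~~ P B -> lam B = 0,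
        \sum_(B : {set gE G}) lam B = 1
      & forall e, x e = \sum_(B : {set gE G}) lam B * incvec B e].

Definition in_matching_polytope (x : gE G -> R) : Prop := in_hull is_matching x.

Definition in_matching_polytope_k (k : nat) (x : gE G -> R) : Prop :=
  in_hull (fun B => is_matching B && (#|B| == k)) x.

Definition xlnx (t : R) : R := if t == 0 then 0 else t * ln t.

Definition bethe_entropy (x : gE G -> R) : R :=
  \sum_(e : gE G) (- xlnx (x e) + xlnx (1 - x e))
  - \sum_(v : gV G) xlnx (1 - \sum_(e : gE G | incident v e) x e).

Definition bethe_free (z : R) (x : gE G -> R) : R :=
  (\sum_(e : gE G) x e) * ln z + bethe_entropy x.

End Graphs.

Arguments in_matching_polytope G {R}.
Arguments in_matching_polytope_k G {R}.
Arguments bethe_entropy G {R}.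
Arguments bethe_free G {R}.

Definition binom_pmf (R : realType) (n k : nat) (p : R) : R :=
  'C(n, k)%:R * p ^+ k * (1 - p) ^+ (n - k).

(* The 2-lift of G given by a choice s : E -> bool for every edge:
   vertices V x {0,1}; edge e = (u,v) gives the two edges
   ((u,b),(v, b xor s e)) for b in {0,1}, i.e. the pair
   {((u,0),(v,0)),((u,1),(v,1))} if s e = false and
   {((u,0),(v,1)),((u,1),(v,0))} if s e = true. *)
Definition lift2 (G : mgraph) (s : gE G -> bool) : mgraph :=
  @MGraph (gV G * bool)%type (gE G * bool)%type
    (fun eb => (((gends eb.1).1, eb.2), ((gends eb.1).2, eb.2 (+) s eb.1))).

Definition is_2lift (G H : mgraph) : Prop := exists s : gE G -> bool, H = lift2 s.

(* Main.v *)
Require Import Defs.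
From HB Require Import structures.
From mathcomp Require Import all_boot all_order all_algebra complex.
From mathcomp Require Import boolp topology normedtype reals sequences exp.
From mathcomp Require Import ring lra zify.
Set Implicit Arguments. Unset Strict Implicit. Unset Printing Implicit Defensive.
Import Order.TTheory GRing.Theory Num.Theory numFieldNormedType.Exports.
Local Open Scope ring_scope.

(* All three parts rest on the monomer-dimer partition function Z(W), indexed by a vertex
   subset W, and on the recurrence Z(W) = mu_a Z(W-a) + sum_(e = ac) w_e Z(W-a-c).

   Lower bound (after Gurvits and Anari-Oveis Gharan): cut all edges into half-edges, so
   that Z factors over vertices and weighted AM-GM applies, and restore the edges one at a
   time; each restoration costs at most the Bethe edge factor because, in a bipartite graph,
   covering the two endpoints of an edge are positively correlated events. This works for
   every fractional matching.

   Fixed size: the matching polynomial is real-rooted (Heilmann-Lieb), so the numbers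
   m_k / binom(nu, k) are log-concave; their supporting line at k together with the lower
   bound at the optimal z gives the binomial factor.

   Lifts: lifting successively along the indicator of every edge kills all shortest cycles,
   hence there is a tower of 2-lifts of girth tending to infinity. Belief propagation
   contracts, so at large girth restoring an edge between half-edges that carry the fixed
   point messages changes Z by the Bethe edge factor up to 1 + o(1). Thus ln P of the lift is
   at most the Bethe value of the fixed point plus o(1) per vertex; the lower bound, applied
   in the lifts, gives both the matching bound and the maximality of the fixed point. *)

(** * Monomer-dimer partition functions *)

Definition loopless (G : mgraph) : Prop :=
  forall e : gE G, (gends e).1 != (gends e).2.

Definition other (G : mgraph) (e : gE G) (v : gV G) : gV G :=
  if (gends e).1 == v then (gends e).2 else (gends e).1.

Lemma bipartite_loopless G : bipartite G -> loopless G.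
Proof. by case=> c hc e; apply: contraNneq (hc e) => ->. Qed.

Section Endpoints.
Variable G : mgraph.
Hypothesis loopG : loopless G.
Implicit Types (e f : gE G) (u v : gV G) (B : {set gE G}).

Lemma incident_l e : incident (gends e).1 e.
Proof. by rewrite /incident eqxx. Qed.

Lemma incident_r e : incident (gends e).2 e.
Proof. by rewrite /incident eqxx orbT. Qed.

Lemma other_l e : other e (gends e).1 = (gends e).2.
Proof. by rewrite /other eqxx. Qed.

Lemma other_r e : other e (gends e).2 = (gends e).1.
Proof. by rewrite /other (negPf (loopG e)). Qed.

Lemma other_neq e v : incident v e -> other e v != v.
Proof.
rewrite /incident /other; case: eqP => [<- _|_ /= /eqP <-] //.
by rewrite eq_sym.
Qed.

Lemma incident_other e v : incident (other e v) e.
Proof. by rewrite /other; case: ifP => _; rewrite ?incident_l ?incident_r. Qed.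

Lemma otherK e v : incident v e -> other e (other e v) = v.
Proof.
move=> /orP[] /eqP <-; first by rewrite other_l other_r.
by rewrite other_r other_l.
Qed.

Lemma incidentE e u v : incident v e -> incident u e = (u == v) || (u == other e v).
Proof.
move=> /orP[] /eqP <-; rewrite ?other_l ?other_r /incident !(eq_sym u) //.
by rewrite orbC.
Qed.

Lemma is_matchingP B :
  reflect (forall e f v, e \in B -> f \in B -> incident v e -> incident v f -> e = f)
          (is_matching B).
Proof.
apply: (iffP forallP) => [hB e f v eB fB ve vf|hB v].
  by apply: (card_le1_eqP (hB v)); rewrite inE ?eB ?fB.
by apply/card_le1_eqP => e f; rewrite !inE => /andP[eB ve] /andP[fB vf]; exact: (hB f e v).
Qed.

Lemma big_incident_ends (K : nmodType) (F : gE G -> gV G -> K) :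
  \sum_v \sum_(e | incident v e) F e v
  = \sum_e (F e (gends e).1 + F e (gends e).2).
Proof.
rewrite (exchange_big_dep xpredT) //=; apply: eq_bigr => e _.
rewrite (bigD1 (gends e).1) ?incident_l //= (bigD1 (gends e).2) /=; last first.
  by rewrite incident_r eq_sym loopG.
rewrite big1 ?addr0 // => v.
rewrite /incident; case: eqP => [<-|_] /=; first by rewrite eqxx.
by case: eqP => [<-|]; rewrite ?eqxx ?andbF.
Qed.

End Endpoints.

Section MonomerDimer.
Variables (G : mgraph) (K : comNzRingType).
Implicit Types (e f : gE G) (u v : gV G) (B : {set gE G}) (W : {set gV G}).
Implicit Types (w : gE G -> K) (mu : gV G -> K).

Definition covered B v := [exists e in B, incident v e].

Definition edges_in W B :=
  [forall e in B, ((gends e).1 \in W) && ((gends e).2 \in W)].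

(* Dimer weight [w e] on each edge, monomer weight [mu v] on each uncovered vertex. *)
Definition mdZ w mu W : K :=
  \sum_(B : {set gE G} | is_matching B && edges_in W B)
    (\prod_(e in B) w e) * \prod_(v in W | ~~ covered B v) mu v.

Lemma edges_inP W B :
  reflect (forall e v, e \in B -> incident v e -> v \in W) (edges_in W B).
Proof.
apply: (iffP forall_inP) => [h e v eB|h e eB].
  by have /andP[h1 h2] := h e eB; case/orP => /eqP <-.
by rewrite (h e _ eB (incident_l e)) (h e _ eB (incident_r e)).
Qed.

Lemma mdZ_set0 w mu : mdZ w mu set0 = 1.
Proof.
rewrite /mdZ (bigD1 set0) /=; last first.
  apply/andP; split; last by apply/edges_inP => e v; rewrite inE.
  by apply/is_matchingP => e f v; rewrite inE.
rewrite !big1 ?mulr1 ?addr0 //.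
- move=> B /andP[/andP[_ /edges_inP hB] /set0Pn[e eB]].
  by have := hB _ _ eB (incident_l e); rewrite inE.
- by move=> v; rewrite inE.
- by move=> e; rewrite inE.
Qed.

Lemma eq_mdZ w w' mu mu' W :
  (forall e, (gends e).1 \in W -> (gends e).2 \in W -> w e = w' e) ->
  {in W, mu =1 mu'} -> mdZ w mu W = mdZ w' mu' W.
Proof.
move=> hw hmu; apply: eq_bigr => B /andP[_ /edges_inP hB]; congr (_ * _).
  by apply: eq_bigr => e eB; apply: hw; apply: (hB e) => //; rewrite ?incident_l ?incident_r.
by apply: eq_bigr => v /andP[vW _]; apply: hmu.
Qed.

Hypothesis loopG : loopless G.

(** The bijection behind the recurrence: [B] corresponds to [e |: B]. The third conjunct expresses
    [e \notin B] in the shape that [reindex_onto] produces. *)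
Lemma matching_cons_iff W a e B :
  a \in W -> incident a e -> other e a \in W ->
  [&& is_matching (e |: B), edges_in W (e |: B) & (e |: B) :\ e == B]
  = is_matching B && edges_in (W :\ a :\ other e a) B.
Proof.
move=> aW ae cW; apply/and3P/andP.
  move=> [/is_matchingP mB /edges_inP iB /eqP eB]; split.
    by apply/is_matchingP => f g v fB gB; apply: mB; rewrite inE ?fB ?gB orbT.
  have neB f : f \in B -> f != e by rewrite -eB !inE => /andP[].
  have feB f : f \in B -> f \in e |: B by move=> fB; rewrite inE fB orbT.
  apply/edges_inP => f v fB vf; rewrite !inE (iB f) ?feB // andbT.
  apply/andP; split; apply: contraTneq (neB f fB) => vE; rewrite negbK; apply/eqP;
    apply: (mB f e v (feB f fB) (setU11 e B) vf); rewrite vE //.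
  exact: incident_other.
move=> [/is_matchingP mB /edges_inP iB].
have nB f v : f \in B -> incident v f -> incident v e -> False.
  move=> fB vf ve; have := iB f v fB vf; rewrite !inE.
  by move: ve; rewrite (incidentE loopG v ae) => /orP[] /eqP->; rewrite eqxx ?andbF.
split.
- apply/is_matchingP => f g v; rewrite !inE => /orP[/eqP->|fB] /orP[/eqP->|gB] // vf vg.
  + by case: (nB g v).
  + by case: (nB f v).
  + exact: (mB f g v).
- apply/edges_inP => f v; rewrite !inE => /orP[/eqP->|fB vf].
    by rewrite (incidentE loopG v ae) => /orP[] /eqP->.
  by have := iB f v fB vf; rewrite !inE => /and3P[].
- rewrite setU1K //; apply/negP => eB; exact: (nB e a).
Qed.

Lemma mdZ_rec w mu W a : a \in W ->
  mdZ w mu W = mu a * mdZ w mu (W :\ a)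
    + \sum_(e | incident a e && (other e a \in W)) w e * mdZ w mu (W :\ a :\ other e a).
Proof.
move=> aW; rewrite /mdZ (bigID (fun B => covered B a)) /= addrC; congr (_ + _).
  rewrite mulr_sumr; apply: eq_big => [B|B /andP[/andP[_ _] naB]].
    rewrite -andbA; congr (_ && _); apply/andP/edges_inP.
      move=> [/edges_inP iB naB] e v eB ve; rewrite !inE (iB _ _ eB ve) andbT.
      by apply: contraNneq naB => <-; apply/exists_inP; exists e.
    move=> iB; split.
      by apply/edges_inP => e v eB ve; have := iB e v eB ve; rewrite !inE => /andP[].
    by apply/negP => /exists_inP[e eB /(iB _ _ eB)]; rewrite !inE eqxx.
  rewrite mulrCA; congr (_ * _); rewrite (bigD1 a) /= ?aW //; congr (_ * _).
  by apply: eq_bigl => v; rewrite !inE andbC andbA.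
(* As [B] is a matching that covers [a], the inner sum has exactly one term; it is inserted so that
   the two sums can be exchanged. *)
transitivity (\sum_(B | (is_matching B && edges_in W B) && covered B a)
   \sum_(e | incident a e && (other e a \in W) && (e \in B))
     (\prod_(e in B) w e) * \prod_(v in W | ~~ covered B v) mu v).
  apply: eq_bigr => B /andP[/andP[/is_matchingP mB /edges_inP iB] /exists_inP[e eB ae]].
  rewrite [RHS](big_pred1 e) // => f; apply/idP/eqP => [/andP[/andP[af _] fB]|->].
    exact: (mB f e a).
  by rewrite ae eB (iB e) ?incident_other.
rewrite (exchange_big_dep (fun e => incident a e && (other e a \in W))) /=; last first.
  by move=> B e _ /andP[].
apply: eq_bigr => e /andP[ae cW]; rewrite mulr_sumr.
rewrite (reindex_onto (fun B => e |: B) (fun B => B :\ e)) /=; last first.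
  by move=> B /andP[_ /andP[_ eB]]; rewrite setD1K.
apply: eq_big => [B|B].
  rewrite -(matching_cons_iff _ aW ae cW) setU11 ae cW /= andbT.
  rewrite -!andbA; congr [&& _, _ & _].
  case: (_ == B); rewrite ?andbF // andbT.
  by apply/exists_inP; exists e; rewrite ?setU11.
move=> /andP[/andP[/andP[/andP[mB iB] _] _] eB].
have := matching_cons_iff B aW ae cW; rewrite mB iB eB => /esym /andP[_ /edges_inP iB'].
have neB : e \notin B by move: eB => /eqP <-; rewrite !inE eqxx.
rewrite big_setU1 //= -mulrA; congr (_ * (_ * _)); apply: eq_bigl => v; rewrite !inE.
have -> : covered (e |: B) v = incident v e || covered B v.
  apply/exists_inP/orP => [[f]|[ve|/exists_inP[f fB vf]]].
  - by rewrite !inE => /orP[/eqP->|fB vf]; [left|right; apply/exists_inP; exists f].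
  - by exists e; rewrite ?setU11.
  - by exists f; rewrite ?inE ?fB ?orbT.
rewrite (incidentE loopG v ae) !negb_or.
by case: (v \in W); case: (v == a); case: (v == other e a); rewrite ?andbF ?andbT.
Qed.

End MonomerDimer.

Section MonomerDimerLinearity.
Variables (G : mgraph) (K : comNzRingType).
Hypothesis loopG : loopless G.
Implicit Types (e : gE G) (W : {set gV G}) (w : gE G -> K) (mu : gV G -> K).

(** The partition function is affine in each single weight: after expansion at [a], none of the
    smaller partition functions sees [mu a]. *)
Lemma mdZ_add_monomer w mu mu' W a y : a \in W -> mu' a = mu a + y ->
  (forall v, v != a -> mu' v = mu v) ->
  mdZ w mu' W = mdZ w mu W + y * mdZ w mu (W :\ a).
Proof.
move=> aW mua muE; rewrite !(mdZ_rec loopG _ _ aW) mua mulrDl addrAC.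
rewrite (@eq_mdZ _ _ w w mu' mu) //; last first.
  by move=> v; rewrite !inE => /andP[/muE].
congr (_ + _ + _); apply: eq_bigr => e _; congr (_ * _).
by apply: eq_mdZ => // v; rewrite !inE => /and3P[_ /muE].
Qed.

Lemma mdZ_add_dimer w w' mu W e t :
  (gends e).1 \in W -> (gends e).2 \in W -> w' e = w e + t ->
  (forall f, f != e -> w' f = w f) ->
  mdZ w' mu W = mdZ w mu W + t * mdZ w mu (W :\ (gends e).1 :\ (gends e).2).
Proof.
move=> aW bW we wE; rewrite !(mdZ_rec loopG _ _ aW).
set a := (gends e).1; have ae : incident a e by apply: incident_l.
have wW f W' : a \notin W' -> (gends f).1 \in W' -> (gends f).2 \in W' -> w' f = w f.
  move=> aW' f1 f2; apply: wE; apply: contraNneq aW' => fe.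
  by rewrite /a -fe.
have eqW W' : a \notin W' -> mdZ w' mu W' = mdZ w mu W'.
  by move=> aW'; apply: eq_mdZ => // f; apply: wW.
rewrite eqW ?inE ?eqxx // -addrA; congr (_ + _).
have ePe : incident a e && (other e a \in W) by rewrite ae other_l.
rewrite (bigD1 e) //= [in RHS](bigD1 e) //= we other_l eqW; last first.
  by rewrite !inE eqxx andbF.
rewrite mulrDl addrAC; congr (_ + _ + _); apply: eq_bigr => f /andP[_ fe].
by rewrite wE // eqW // !inE eqxx andbF.
Qed.

End MonomerDimerLinearity.

Section MonomerDimerReal.
Variables (G : mgraph) (R : realFieldType).
Hypothesis loopG : loopless G.
Implicit Types (e : gE G) (u v : gV G) (W : {set gV G}).
Variables (w : gE G -> R) (mu : gV G -> R).
Hypothesis w_ge0 : forall e, 0 <= w e.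

Lemma mdZ_gt0 W : (forall v, 0 < mu v) -> 0 < mdZ w mu W.
Proof.
move=> mu0; move: {2}#|W|.+1 (ltnSn #|W|) => n; elim: n W => // n IHn W.
have [->|[a aW]] := set_0Vmem W; first by rewrite mdZ_set0.
rewrite (cardsD1 a W) aW ltnS add1n => hW.
rewrite (mdZ_rec loopG _ _ aW) ltr_wpDr ?mulr_gt0 ?IHn //.
apply: sumr_ge0 => e _; rewrite mulr_ge0 // ltW // IHn //.
by apply: leq_ltn_trans hW; apply: subset_leq_card; rewrite subsetDl.
Qed.

(* Expanding at [u] turns the correlation of [u] and [v] into a sum of squares minus the
   correlations of [v] with the neighbours of [u] in [W :\ u], hence the alternation. *)
Lemma mdZ_correlation (c : gV G -> bool) W u v :
  (forall e, c (gends e).1 != c (gends e).2) ->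
  u \in W -> v \in W -> u != v ->
  if c u == c v
  then mdZ w mu W * mdZ w mu (W :\ u :\ v) <= mdZ w mu (W :\ u) * mdZ w mu (W :\ v)
  else mdZ w mu (W :\ u) * mdZ w mu (W :\ v) <= mdZ w mu W * mdZ w mu (W :\ u :\ v).
Proof.
move=> hc; move: {2}#|W|.+1 (ltnSn #|W|) => n; elim: n W u v => // n IHn W u v.
move=> + uW vW uv; rewrite (cardsD1 u W) uW ltnS add1n => hW.
set Z := mdZ w mu.
pose D e := Z (W :\ u :\ other e u) * Z (W :\ u :\ v)
  - (if other e u == v then 0 else Z (W :\ u) * Z (W :\ u :\ v :\ other e u)).
(* Both [Z W] and [Z (W :\ v)] are expanded at [u]; the terms containing [mu u] cancel. An edge from
   [u] to [v] occurs only in the first expansion, hence the case distinction in [D]. *)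
have key : Z W * Z (W :\ u :\ v) - Z (W :\ u) * Z (W :\ v)
    = \sum_(e | incident u e && (other e u \in W)) w e * D e.
  have uWv : u \in W :\ v by rewrite !inE uv.
  rewrite /Z (mdZ_rec loopG w mu uW) (mdZ_rec loopG w mu uWv) -/Z.
  have setDDC (A : {set gV G}) x y : A :\ x :\ y = A :\ y :\ x.
    by apply/setP => t; rewrite !inE andbCA.
  rewrite (setDDC W v u) mulrDl mulrDr.
  have -> : \sum_(e | incident u e && (other e u \in W)) w e * D e =
    \sum_(e | incident u e && (other e u \in W))
       w e * (Z (W :\ u :\ other e u)) * Z (W :\ u :\ v)
    - \sum_(e | incident u e && (other e u \in W :\ v))
       w e * (Z (W :\ u) * Z (W :\ u :\ v :\ other e u)).
    rewrite [X in _ - X](_ : _ = \sum_(e | incident u e && (other e u \in W))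
       w e * (if other e u == v then 0 else Z (W :\ u) * Z (W :\ u :\ v :\ other e u))).
      by rewrite -sumrB; apply: eq_bigr => e _; rewrite /D mulrBr mulrA.
    rewrite [RHS](bigID (fun e => other e u == v)) /=.
    rewrite [X in _ = X + _]big1 ?add0r; last first.
      by move=> e /andP[_ /eqP ->]; rewrite eqxx mulr0.
    apply: eq_big => [e|e]; rewrite !inE; last by case/and3P=> _ /negPf->.
    by case: (incident u e); case: (other e u == v); rewrite ?andbF ?andbT.
  rewrite -mulr_suml.
  have -> : \sum_(e | incident u e && (other e u \in W :\ v))
       w e * (Z (W :\ u) * Z (W :\ u :\ v :\ other e u)) =
     Z (W :\ u) * \sum_(e | incident u e && (other e u \in W :\ v))
       w e * Z (W :\ u :\ v :\ other e u).
    by rewrite mulr_sumr; apply: eq_bigr => e _; rewrite mulrCA.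
  by ring.
have cE e : incident u e -> c (other e u) = ~~ c u.
  rewrite /other => /orP[] /eqP <-; rewrite ?eqxx.
    by move: (hc e); case: (c _); case: (c _).
  by rewrite (negPf (loopG e)); move: (hc e); case: (c _); case: (c _).
have IHe e : incident u e -> other e u \in W -> other e u != v ->
    let o := other e u in
  if c o == c v
  then Z (W :\ u) * Z (W :\ u :\ o :\ v) <= Z (W :\ u :\ o) * Z (W :\ u :\ v)
  else Z (W :\ u :\ o) * Z (W :\ u :\ v) <= Z (W :\ u) * Z (W :\ u :\ o :\ v).
  move=> ue oW ov; apply: IHn => //; rewrite !inE ?oW ?vW ?andbT ?(other_neq loopG) //.
  by rewrite eq_sym.
have setDDC (A : {set gV G}) x y : A :\ x :\ y = A :\ y :\ x.
  by apply/setP => t; rewrite !inE andbCA.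
case: ifP => cuv.
  rewrite -subr_le0 key; apply: sumr_le0 => e /andP[ue oW].
  apply: mulr_ge0_le0 => //; rewrite /D; have := cE e ue.
  case: eqP => [-> | /eqP ov co]; first by rewrite -(eqP cuv); case: (c u).
  have := IHe e ue oW ov; rewrite /= co -(eqP cuv); case: (c u) => /=;
  by rewrite (setDDC (W :\ u) v) subr_le0.
rewrite -subr_ge0 key; apply: sumr_ge0 => e /andP[ue oW].
apply: mulr_ge0 => //; rewrite /D; have := cE e ue.
case: eqP => [-> co | /eqP ov co]; first by rewrite subr0 -expr2 sqr_ge0.
have := IHe e ue oW ov; rewrite /= co; move: cuv; case: (c u); case: (c v) => //= _;
by rewrite (setDDC (W :\ u) v) subr_ge0.
Qed.

End MonomerDimerReal.

(** * Entropy inequalities and the cost of restoring an edge *)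

Section RealLemmas.
Variable R : realType.
Implicit Types (x y t l T : R).

Lemma ln_le_sub1 x : 0 < x -> ln x <= x - 1.
Proof.
move=> x0; have := @le_ln1Dx R (x - 1); rewrite addrCA subrr addr0; apply; lra.
Qed.

Lemma ln_prod (I : finType) (F : I -> R) : (forall i, 0 < F i) ->
  ln (\prod_i F i) = \sum_i ln (F i).
Proof.
move=> F0; suff [] : 0 < \prod_i F i /\ ln (\prod_i F i) = \sum_i ln (F i) by [].
elim/big_rec2: _ => [|i a b _ [b0 <-]]; first by rewrite ln1.
by rewrite mulr_gt0 // lnM ?posrE.
Qed.

Lemma xlnx0 : xlnx (0 : R) = 0. Proof. by rewrite /xlnx eqxx. Qed.

Lemma xlnx1 : xlnx (1 : R) = 0. Proof. by rewrite /xlnx oner_eq0 ln1 mulr0. Qed.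

Lemma xlnxE x : xlnx x = x * ln x.
Proof. by rewrite /xlnx; case: eqP => [->|] //; rewrite mul0r. Qed.

(** One term of Gibbs' inequality, from [ln s <= s - 1] at [s = t / (l * T)]. Summed over a
    probability vector [l], with [T] the sum of the [t], the corrections [t / T - l] cancel. *)
Lemma gibbs_term l t T : 0 <= l -> 0 <= t -> (0 < l -> 0 < t) -> 0 < T ->
  l * ln t - xlnx l <= l * ln T + t / T - l.
Proof.
move=> l0 t0 lt T0; have [->|ln0] := eqVneq l 0.
  by rewrite xlnx0 !mul0r subr0 subr0 add0r divr_ge0 // ltW.
have lp : 0 < l by rewrite lt_def ln0.
have tp := lt lp; rewrite xlnxE -mulrBr.
have := @ln_le_sub1 (t / (l * T)); rewrite divr_gt0 ?mulr_gt0 // => /(_ isT).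
rewrite ln_div ?posrE ?mulr_gt0 // lnM ?posrE // => h.
have : l * (ln t - (ln l + ln T)) <= l * (t / (l * T) - 1) by rewrite ler_wpM2l.
have -> : l * (t / (l * T) - 1) = t / T - l by field; rewrite ?ln0 ?gt_eqF.
lra.
Qed.

Lemma ln_add_ge a b x : 0 < a -> 0 < b -> 0 <= x -> x <= 1 ->
  (1 - x) * ln a + x * ln b - xlnx x - xlnx (1 - x) <= ln (a + b).
Proof.
move=> a0 b0 x0 x1; have ab0 : 0 < a + b by rewrite addr_gt0.
have h1 := gibbs_term x0 (ltW b0) (fun=> b0) ab0.
have h2 : (1 - x) * ln a - xlnx (1 - x) <= (1 - x) * ln (a + b) + a / (a + b) - (1 - x).
  by apply: gibbs_term => //; [rewrite subr_ge0|rewrite ltW].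
have : a / (a + b) + b / (a + b) = 1 by rewrite -mulrDl divff // gt_eqF.
lra.
Qed.

(** Weighted AM-GM at a vertex: the summand 1, for the uncovered state, carries the remaining mass
    [1 - \sum x]. *)
Lemma ln_star_ge (I : finType) (P : pred I) (x t : I -> R) :
  (forall i, P i -> 0 <= x i) -> \sum_(i | P i) x i <= 1 ->
  (forall i, P i -> 0 <= t i) -> (forall i, P i -> 0 < x i -> 0 < t i) ->
  \sum_(i | P i) (x i * ln (t i) - xlnx (x i)) - xlnx (1 - \sum_(i | P i) x i)
   <= ln (1 + \sum_(i | P i) t i).
Proof.
move=> x0 x1 t0 t0'; set T := (X in _ <= ln X).
have T0 : 0 < T by apply: ltr_pwDl => //; apply: sumr_ge0.
have h1 : \sum_(i | P i) (x i * ln (t i) - xlnx (x i))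
   <= \sum_(i | P i) (x i * ln T + t i / T - x i).
  by apply: ler_sum => i Pi; apply: gibbs_term; auto.
have h2 : (1 - \sum_(i | P i) x i) * ln 1 - xlnx (1 - \sum_(i | P i) x i)
   <= (1 - \sum_(i | P i) x i) * ln T + 1 / T - (1 - \sum_(i | P i) x i).
  by apply: gibbs_term => //; rewrite subr_ge0.
have eT : \sum_(i | P i) (x i * ln T + t i / T - x i)
    = (\sum_(i | P i) x i) * ln T + (\sum_(i | P i) t i) / T - \sum_(i | P i) x i.
  by rewrite sumrB big_split /= -!mulr_suml.
rewrite eT in h1.
have : 1 / T + (\sum_(i | P i) t i) / T = 1 by rewrite -mulrDl divff // gt_eqF.
move: h2; rewrite ln1 mulr0; lra.
Qed.

(** A limit [t -> 0] in elementary form; it serves the boundary cases [x = 1] in [join_halfedges]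
    and [k = 0], [k = nu G] in [mcount_ge]. *)
Lemma ler_of_linear a b x : (forall t, 0 < t -> t <= 1 -> x <= a + t * b) -> x <= a.
Proof.
move=> h; rewrite leNgt; apply/negP => ax.
have b0 : 0 < b by have := h 1 ltr01 (lexx _); lra.
have := h (Num.min 1 ((x - a) / (2 * b))).
rewrite lt_min ltr01 divr_gt0 ?subr_gt0 ?mulr_gt0 // => /(_ isT).
rewrite ge_min lexx => /(_ isT).
have : Num.min 1 ((x - a) / (2 * b)) * b <= (x - a) / 2.
  rewrite -[leRHS](_ : (x - a) / (2 * b) * b = _); last by field; rewrite gt_eqF.
  by apply: ler_wpM2r; [apply: ltW|rewrite ge_min lexx orbT].
lra.
Qed.

(* [A + p B + p' C + p p' D] is the partition function with an edge cut into two
   half-edges of weights [p] and [p'], and [A + w D] the one with the edge restored. *)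
Lemma join_halfedges (A B C D w x k : R) :
  0 < A -> 0 < B -> 0 < C -> 0 < D -> B * C <= A * D -> 0 < w -> 0 <= x -> x <= 1 ->
  (forall p p', 0 <= p -> 0 <= p' -> (0 < x -> 0 < p /\ 0 < p') ->
     k + x * (ln p + ln p') <= ln (A + p * B + p' * C + p * p' * D)) ->
  k + x * ln w + xlnx x + xlnx (1 - x) <= ln (A + w * D).
Proof.
move=> A0 B0 C0 D0 BC w0 x0 x1 h.
have AwD : 0 < A + w * D by rewrite addr_gt0 // mulr_gt0.
have [xz|xn0] := eqVneq x 0.
  have := h 0 0 (lexx _) (lexx _); rewrite xz ltxx !mul0r !addr0.
  move=> /(_ (fun H => False_ind _ (notF H))) hk.
  rewrite xlnx0 subr0 xlnx1 !addr0 (le_trans hk) // ler_ln ?posrE //.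
  by rewrite lerDl ltW // mulr_gt0.
have xp : 0 < x by rewrite lt_def xn0.
(* For [x = 1] the optimal half-edge weights are infinite: take both equal to [t^-1] and let [t]
   tend to 0, which isolates [D]. *)
have [xe1|xn1] := eqVneq x 1.
  rewrite xe1 subrr xlnx0 xlnx1 !addr0 mul1r.
  have hD : expR k <= D.
    apply: (@ler_of_linear _ (A + B + C)) => t t0 t1.
    have ti0 : 0 < t^-1 by rewrite invr_gt0.
    have := h t^-1 t^-1 (ltW ti0) (ltW ti0) (fun=> conj ti0 ti0).
    rewrite xe1 mul1r -(ler_expR (k + _)) lnK ?posrE ?addr_gt0 ?mulr_gt0 //.
    rewrite expRD expRD lnK ?posrE // => hk.
    have tt0 : 0 < t * t by rewrite mulr_gt0.
    have : t * t * (expR k * (t^-1 * t^-1)) <=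
           t * t * (A + t^-1 * B + t^-1 * C + t^-1 * t^-1 * D).
      by rewrite ler_wpM2l // ltW.
    have -> : t * t * (expR k * (t^-1 * t^-1)) = expR k by field; rewrite gt_eqF.
    have -> : t * t * (A + t^-1 * B + t^-1 * C + t^-1 * t^-1 * D) =
       t * t * A + t * (B + C) + D by field; rewrite gt_eqF.
    have : t * t * A <= t * A by rewrite ler_wpM2r ?ler_piMl // ltW.
    lra.
  have -> : k + ln w = ln (expR k * w) by rewrite lnM ?posrE ?expR_gt0 // expRK.
  rewrite ler_ln ?posrE ?mulr_gt0 ?expR_gt0 // ler_wpDl ?(ltW A0) //.
  by rewrite mulrC ler_wpM2l // ltW.
have xlt1 : 0 < 1 - x by rewrite subr_gt0 lt_def eq_sym xn1.
have [t t0 tE] : exists2 t : R, 0 < t & t = x / (1 - x).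
  by exists (x / (1 - x)); rewrite ?divr_gt0.
(* The weights are tuned so that [p * B = t * A] and [p * p' * D = t ^ 2 * A]. The correlation
   hypothesis gives [p' * C <= t * A], so the whole sum is at most
   [A * (1 + t) ^ 2 = A / (1 - x) ^ 2]. *)
pose p : R := t * A / B; pose p' : R := t * B / D.
have p0 : 0 < p by rewrite /p divr_gt0 // mulr_gt0.
have p'0 : 0 < p' by rewrite /p' divr_gt0 // mulr_gt0.
have := h p p' (ltW p0) (ltW p'0) (fun=> conj p0 p'0) => {h}.
have pB : p * B = t * A by rewrite /p; field; rewrite gt_eqF.
have p'C : p' * C <= t * A.
  by rewrite /p' mulrAC ler_pdivrMr // -!mulrA ler_wpM2l // ltW.
have ppD : p * p' * D = t * t * A by rewrite /p /p'; field; rewrite !gt_eqF.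
have lpp : ln p + ln p' = 2 * ln t + ln A - ln D.
  rewrite /p /p' !ln_div ?posrE ?mulr_gt0 // !lnM ?posrE //; lra.
clearbody p p'.
have lt : ln t = ln x - ln (1 - x) by rewrite tE ln_div ?posrE.
have hT : ln (A + p * B + p' * C + p * p' * D) <= ln A - 2 * ln (1 - x).
  have -> : ln A - 2 * ln (1 - x) = ln (A / ((1 - x) * (1 - x))).
    rewrite ln_div ?lnM ?posrE ?mulr_gt0 //; lra.
  rewrite ler_ln ?posrE ?divr_gt0 ?addr_gt0 ?mulr_gt0 //.
  have -> : A / ((1 - x) * (1 - x)) = A + t * A + t * A + t * t * A.
    by rewrite tE; field; rewrite gt_eqF.
  by rewrite pB ppD; lra.
move=> hk; have := le_trans hk hT; rewrite lpp lt => {}hk.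
have wD0 : 0 < w * D by rewrite mulr_gt0.
have := ln_add_ge A0 wD0 x0 x1; apply: le_trans.
rewrite lnM ?posrE // !xlnxE; nra.
Qed.

End RealLemmas.

(** * The Bethe lower bound *)

Section HalfEdges.
Variables (G : mgraph) (R : realType).
Hypothesis loopG : loopless G.
Implicit Types (e : gE G) (v : gV G) (S : {set gE G}) (w : gE G -> R).
Implicit Types (y : gE G -> gV G -> R).

Definition joined_weight S w e : R := if e \in S then w e else 0.

Definition halfedge_monomer S y v : R :=
  1 + \sum_(e | incident v e && (e \notin S)) y e v.

(* Every edge outside [S] is cut into two pendant half-edges, whose weights
   [y e v] are absorbed into the monomer weights of the endpoints [v]. *)
Definition cutZ S w y (W : {set gV G}) : R :=
  mdZ (joined_weight S w) (halfedge_monomer S y) W.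

Lemma eq_halfedge_monomer S y y' v :
  (forall e, e \notin S -> y e v = y' e v) ->
  halfedge_monomer S y v = halfedge_monomer S y' v.
Proof. by move=> h; congr (1 + _); apply: eq_bigr => e /andP[_ /h]. Qed.

Lemma halfedge_monomer_setU1 S y e v : e \notin S ->
  halfedge_monomer S y v
    = halfedge_monomer (e |: S) y v + (if incident v e then y e v else 0).
Proof.
move=> eS; rewrite /halfedge_monomer -addrA; congr (1 + _).
case: ifP => ve.
  rewrite (bigD1 e) ?ve //= addrC; congr (_ + _); apply: eq_bigl => f.
  by rewrite !inE negb_or -andbA [(f \notin S) && _]andbC.
rewrite addr0; apply: eq_bigl => f; rewrite !inE negb_or.
by case: eqP => [->|]; rewrite ?ve.
Qed.

Lemma halfedge_monomer_gt0 S y v : (forall e v, incident v e -> 0 <= y e v) ->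
  0 < halfedge_monomer S y v.
Proof. by move=> y0; apply: ltr_pwDl => //; apply: sumr_ge0 => e /andP[/y0]. Qed.

(* Here [e] is neither joined nor cut into half-edges, but absent. *)
Definition delZ e S w y W : R :=
  mdZ (joined_weight S w) (halfedge_monomer (e |: S) y) W.

Section OneEdge.
Variables (e : gE G) (S : {set gE G}) (w : gE G -> R) (y : gE G -> gV G -> R).
Hypothesis eS : e \notin S.
Let a := (gends e).1.
Let b := (gends e).2.

(** Together with [cutZ_join], this puts the cut and the restored edge into the form compared by
    [join_halfedges]. *)
Lemma cutZ_cut : cutZ S w y setT =
  delZ e S w y setT + y e a * delZ e S w y (setT :\ a)
  + y e b * delZ e S w y (setT :\ b)
  + y e a * y e b * delZ e S w y (setT :\ a :\ b).
Proof.
have ab : a != b := loopG e.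
pose mu1 v := halfedge_monomer (e |: S) y v + (if v == a then y e a else 0).
have mu1E (W : {set gV G}) : a \in W -> mdZ (joined_weight S w) mu1 W
    = delZ e S w y W + y e a * delZ e S w y (W :\ a).
  move=> aW; apply: mdZ_add_monomer => //; rewrite /mu1 ?eqxx //.
  by move=> v /negPf->; rewrite addr0.
have -> : cutZ S w y setT
    = mdZ (joined_weight S w) mu1 setT + y e b * mdZ (joined_weight S w) mu1 (setT :\ b).
  apply: (mdZ_add_monomer loopG _ (in_setT b)) => [|v vb].
    by rewrite (halfedge_monomer_setU1 _ _ eS) incident_r /mu1 eq_sym (negPf ab) addr0.
  rewrite (halfedge_monomer_setU1 _ _ eS) /mu1 (incidentE loopG v (incident_l e)) other_l -/a -/b.
  by rewrite (negPf vb) orbF; case: eqP => // ->.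
rewrite !mu1E ?inE ?ab //.
have -> : setT :\ b :\ a = setT :\ a :\ b by apply/setP => v; rewrite !inE andbCA.
by ring.
Qed.

Lemma cutZ_join : cutZ (e |: S) w y setT =
  delZ e S w y setT + w e * delZ e S w y (setT :\ a :\ b).
Proof.
apply: mdZ_add_dimer; rewrite ?inE //.
  by rewrite /joined_weight setU11 (negPf eS) add0r.
by move=> f fe; rewrite /joined_weight !inE (negPf fe).
Qed.

End OneEdge.

Lemma delZ_gt0 e S w y W : (forall e, 0 <= w e) ->
  (forall e v, incident v e -> 0 <= y e v) -> 0 < delZ e S w y W.
Proof.
move=> w0 y0; apply: mdZ_gt0 => //.
  by move=> f; rewrite /joined_weight; case: ifP.
by move=> v; apply: halfedge_monomer_gt0.
Qed.

Lemma cutZ_gt0 S w y W : (forall e, 0 <= w e) ->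
  (forall e v, incident v e -> 0 <= y e v) -> 0 < cutZ S w y W.
Proof.
move=> w0 y0; apply: mdZ_gt0 => //.
  by move=> f; rewrite /joined_weight; case: ifP.
by move=> v; apply: halfedge_monomer_gt0.
Qed.

Lemma cutZ_set0 w y :
  cutZ set0 w y setT = \prod_v (1 + \sum_(e | incident v e) y e v).
Proof.
have gen n (W : {set gV G}) : (#|W| <= n)%N ->
    cutZ set0 w y W = \prod_(v in W) (1 + \sum_(e | incident v e) y e v).
  elim: n W => [|n IHn] W.
    by rewrite leqn0 cards_eq0 => /eqP->; rewrite big_set0 /cutZ mdZ_set0.
  have [->|[v vW]] := set_0Vmem W; first by rewrite big_set0 /cutZ mdZ_set0.
  rewrite (cardsD1 v) vW add1n ltnS => hW; rewrite /cutZ (mdZ_rec loopG _ _ vW).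
  rewrite [X in _ + X]big1 => [|e _]; last by rewrite /joined_weight inE mul0r.
  rewrite addr0 -/(cutZ _ _ _ _) IHn // (big_setD1 v vW) /=; congr (_ * _).
  by congr (1 + _); apply: eq_bigl => e; rewrite inE andbT.
by rewrite (gen _ _ (leqnn _)); apply: eq_bigl => v; rewrite inE.
Qed.

End HalfEdges.

Section FractionalBound.
Variables (G : mgraph) (R : realType).
Hypothesis bipG : bipartite G.
Let loopG := bipartite_loopless bipG.
Variable w : gE G -> R.
Hypothesis w_gt0 : forall e, 0 < w e.

(** The degree relaxation of the matching polytope: it suffices for the lower bound and passes to
    lifts at once. [fractional_matching_in_hull] leads back to the polytope. *)
Definition fractional_matching (x : gE G -> R) : Prop :=
  (forall e, 0 <= x e) /\ (forall v, \sum_(e | incident v e) x e <= 1).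

Variable x : gE G -> R.
Hypothesis fmx : fractional_matching x.

Let x_ge0 e : 0 <= x e := fmx.1 e.

Lemma fractional_matching_le1 e : x e <= 1.
Proof.
apply: le_trans (fmx.2 (gends e).1); rewrite (bigD1 e) ?incident_l //= lerDl.
by apply: sumr_ge0.
Qed.

(** Weights may vanish where [x e = 0], because [join_halfedges] tests [p = p' = 0] there. *)
Let admissible (y : gE G -> gV G -> R) :=
  (forall e v, incident v e -> 0 <= y e v)
  /\ (forall e v, incident v e -> 0 < x e -> 0 < y e v).

(** Each half of an edge contributes [- xlnx (x e)]; joining adds the Bethe edge term. At [S = setT]
    this is the Bethe entropy plus the weight term. *)
Let bound (S : {set gE G}) : R :=
  \sum_v (- xlnx (1 - \sum_(e | incident v e) x e)) - 2 * \sum_e xlnx (x e)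
  + \sum_(e in S) (x e * ln (w e) + xlnx (x e) + xlnx (1 - x e)).

Let ends_ln (y : gE G -> gV G -> R) e : R :=
  x e * (ln (y e (gends e).1) + ln (y e (gends e).2)).

(** Induction on the joined edges: AM-GM at every vertex for [S = set0], then [join_halfedges]. The
    claim ranges over all admissible [y], since the step needs it for arbitrary weights [p], [p'] on
    the two halves of the edge being joined. *)
Let bound_cutZ S y : admissible y ->
  bound S + \sum_(e in ~: S) ends_ln y e <= ln (cutZ S w y setT).
Proof.
have [m] := ubnP #|S|; elim: m S y => // m IHm S y cS [y0 y1].
have [S0|[e eS]] := set_0Vmem S.
  rewrite S0 /bound big_set0 addr0 cutZ_set0 //.
  rewrite ln_prod; last first.
    by move=> v; apply: ltr_pwDl => //; apply: sumr_ge0 => e; apply: y0.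
  have : \sum_v (\sum_(e | incident v e) (x e * ln (y e v) - xlnx (x e))
      - xlnx (1 - \sum_(e | incident v e) x e))
      <= \sum_v ln (1 + \sum_(e | incident v e) y e v).
    apply: ler_sum => v _; apply: ln_star_ge => // [|e|e]; [exact: fmx.2|exact: y0|exact: y1].
  apply: le_trans; rewrite big_split /= (big_incident_ends loopG) [leRHS]addrC -!addrA.
  rewrite lerD2l setC0 mulr_sumr -sumrN.
  rewrite [X in _ + X](eq_bigl xpredT) => [|e]; last by rewrite inE.
  rewrite -big_split /=.
  apply: ler_sum => e _; rewrite /ends_ln; lra.
pose S' := S :\ e; have eS' : e \notin S' by rewrite !inE eqxx.
have SE : S = e |: S' by rewrite setD1K.
have cS' : (#|S'| < m)%N by rewrite -ltnS (leq_ltn_trans _ cS) // [leqRHS](cardsD1 e) eS.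
have y0w f : 0 <= w f by rewrite ltW.
have w0 : 0 < w e by [].
have dZ0 W : 0 < delZ e S' w y W by apply: delZ_gt0.
have [c hc] := bipG.
set a := (gends e).1; set b := (gends e).2; have ab : a != b := loopG e.
have cor : delZ e S' w y (setT :\ a) * delZ e S' w y (setT :\ b)
    <= delZ e S' w y setT * delZ e S' w y (setT :\ a :\ b).
  have := @mdZ_correlation _ _ loopG (joined_weight S' w) (halfedge_monomer (e |: S') y) _
     c setT a b hc (in_setT _) (in_setT _) ab.
  rewrite (negPf (hc e)); apply.
  by move=> f; rewrite /joined_weight; case: ifP.
have SC : \sum_(f in ~: S') ends_ln y f = ends_ln y e + \sum_(f in ~: S) ends_ln y f.
  rewrite (bigD1 e) /= ?inE ?eqxx //; congr (_ + _).
  by apply: eq_bigl => f; rewrite !inE; case: eqP => [->|_]; rewrite ?eS ?andbT ?andbF.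
have bS : bound S = bound S' + (x e * ln (w e) + xlnx (x e) + xlnx (1 - x e)).
  by rewrite {1}SE /bound big_setU1 //= [in RHS]addrAC -addrA.
rewrite bS [X in cutZ X]SE (cutZ_join loopG) //.
set k := bound S' + \sum_(f in ~: S) ends_ln y f.
suff hk p p' : 0 <= p -> 0 <= p' -> (0 < x e -> 0 < p /\ 0 < p') ->
    k + x e * (ln p + ln p') <= ln (delZ e S' w y setT + p * delZ e S' w y (setT :\ a)
      + p' * delZ e S' w y (setT :\ b) + p * p' * delZ e S' w y (setT :\ a :\ b)).
  have := join_halfedges (dZ0 setT) (dZ0 (setT :\ a)) (dZ0 (setT :\ b))
    (dZ0 (setT :\ a :\ b)) cor w0 (x_ge0 e) (fractional_matching_le1 e) hk.
  by apply: le_trans; rewrite /k; lra.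
move=> p0 p'0 px.
pose y' f v := if f == e then (if v == a then p else p') else y f v.
have admy' : admissible y'.
  split=> f v vf; rewrite /y'; case: (eqVneq f e) => [fe|_].
  - by case: ifP.
  - exact: y0.
  - by rewrite fe => /px[? ?]; case: ifP.
  - exact: y1.
have dy W : delZ e S' w y' W = delZ e S' w y W.
  apply: eq_mdZ => // v _; apply: eq_halfedge_monomer => f.
  by rewrite !inE negb_or /y' => /andP[/negPf->].
have := IHm S' y' cS' admy'.
rewrite (cutZ_cut loopG _ _ eS') !dy -/a -/b /y' !eqxx [b == a]eq_sym (negPf ab).
apply: le_trans; rewrite (bigD1 e) /= ?inE ?eqxx // /k -addrA lerD2l addrC.
rewrite /ends_ln eqxx -/a -/b eqxx [b == a]eq_sym (negPf ab) lerD2l.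
rewrite [leRHS](_ : _ = \sum_(f in ~: S) ends_ln y f) // /ends_ln.
apply: eq_big => [f|f]; first by rewrite !inE; case: eqP => [->|_]; rewrite ?eS ?andbT ?andbF.
by move=> /andP[_ /negPf->].
Qed.

Lemma fractional_matching_bound :
  \sum_e x e * ln (w e) + bethe_entropy G x <= ln (mdZ w (fun=> 1) setT).
Proof.
(* Once all edges are joined no half-edge is left, so the weights 1 are an arbitrary choice. *)
have := @bound_cutZ setT (fun _ _ => 1) (conj (fun _ _ _ => ler01) (fun _ _ _ _ => ltr01)).
rewrite setCT big_set0 addr0 /cutZ.
rewrite (@eq_mdZ _ _ _ w _ (fun=> 1)) => [|e _ _|v _]; first last.
- rewrite /halfedge_monomer big1 ?addr0 // => e; by rewrite inE andbF.
- by rewrite /joined_weight inE.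
apply: le_trans; rewrite /bound /bethe_entropy.
rewrite [X in _ <= _ + X](eq_bigl xpredT) => [|e]; last by rewrite inE.
rewrite sumrN !big_split /= sumrN; lra.
Qed.

End FractionalBound.

(** * Real-rootedness and Newton's inequalities *)

Section MatchingPolynomial.
Variables (G : mgraph).

Lemma card_le_nu (B : {set gE G}) : is_matching B -> (#|B| <= nu G)%N.
Proof. by move=> mB; apply: (@leq_bigmax_cond _ _ (fun B : {set gE G} => #|B|)). Qed.

Lemma is_matching0 : is_matching (set0 : {set gE G}).
Proof. by apply/is_matchingP => e f v; rewrite inE. Qed.

(** The ring is arbitrary because the identity is used over the reals and, for the location of the
    roots, over the complex numbers. *)
Lemma mdZ_const (K : comNzRingType) (z : K) :
  mdZ (fun _ : gE G => z) (fun=> 1) setT = \sum_(k < (nu G).+1) (mcount G k)%:R * z ^+ k.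
Proof.
rewrite /mdZ.
transitivity (\sum_(B : {set gE G} | is_matching B) z ^+ #|B|).
  apply: eq_big => [B|B _].
    by rewrite (_ : edges_in setT B) ?andbT //; apply/edges_inP => e v; rewrite inE.
  by rewrite [X in _ * X]big1 // mulr1 prodr_const.
(* No matching has more than [nu G] edges, so [inord] never takes its default value. *)
rewrite (partition_big (fun B : {set gE G} => inord #|B|) (fun _ : 'I_(nu G).+1 => true)) //=.
apply: eq_bigr => k _; rewrite (eq_bigr (fun=> z ^+ k)) => [|B /andP[mB /eqP <-]].
  rewrite -big_filter big_const_seq /mcount count_predT size_filter.
  pose Mk := [set B : {set gE G} | is_matching B && (#|B| == k)].
  rewrite -sum1_card -sum1_count [X in iter X](eq_bigl _ _ (_ : _ =1 mem Mk)).
    by rewrite iter_addr_0 mulr_natl.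
  move=> B; rewrite !inE; case mB: (is_matching B) => //=.
  by rewrite -val_eqE /= inordK // ltnS card_le_nu.
by rewrite inordK // ltnS card_le_nu.
Qed.

Lemma mcount0 : mcount G 0 = 1%N.
Proof.
rewrite /mcount (_ : [set _ | _] = [set set0]) ?cards1 //.
apply/setP => B; rewrite !inE cards_eq0.
by case: eqP => [->|]; rewrite ?is_matching0 ?andbF.
Qed.

Lemma mcount_nu_gt0 : (0 < mcount G (nu G))%N.
Proof.
rewrite /nu (bigop.bigmax_eq_arg set0) ?is_matching0 //.
case: arg_maxnP => [|B mB _]; first exact: is_matching0.
by apply/card_gt0P; exists B; rewrite inE mB eqxx.
Qed.

Lemma matching_polyE (R : realType) (z : R) :
  matching_poly G z = mdZ (fun _ : gE G => z) (fun=> 1) setT.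
Proof. by rewrite mdZ_const. Qed.

Lemma in_hull_fractional (R : realType) (P : {set gE G} -> bool) (x : gE G -> R) :
  (forall B, P B -> is_matching B) -> in_hull P x -> fractional_matching x.
Proof.
move=> Pm [lam [lam0 lamP lam1 xE]]; split=> [e|v].
  by rewrite xE sumr_ge0 // => B _; rewrite mulr_ge0 // /incvec ler0n.
rewrite (eq_bigr _ (fun e _ => xE e)) exchange_big /= -lam1 ler_sum // => B _.
have [PB|/lamP->] := boolP (P B); last by rewrite big1 // => e; rewrite mul0r.
rewrite -mulr_sumr ler_piMr // /incvec -natr_sum -[leRHS]/(1%:R) ler_nat.
apply: leq_trans (forallP (Pm B PB) v); rewrite -sum1_card big_mkcond /= [leqRHS]big_mkcond /=.
by apply: leq_sum => e _; rewrite !inE andbC; case: (incident v e); case: (e \in B).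
Qed.

End MatchingPolynomial.

Lemma matching_poly_ge (R : realType) (G : mgraph) (x : gE G -> R) (z : R) :
  bipartite G -> fractional_matching x -> 0 < z ->
  bethe_free G z x <= ln (matching_poly G z).
Proof.
move=> bipG fx z0; rewrite matching_polyE.
have := @fractional_matching_bound G R bipG (fun=> z) (fun=> z0) x fx.
by rewrite -mulr_suml.
Qed.

Section HeilmannLieb.
Variables (G : mgraph) (C : numClosedFieldType).
Hypothesis loopG : loopless G.

Lemma Re_inv_gt0 (t : C) : 0 < 'Re t -> 0 < 'Re (t^-1).
Proof.
move=> t0; rewrite invC_norm.
have nt : t != 0 by apply: contraTneq t0 => ->; rewrite raddf0 ltxx.
rewrite ReMl; last by rewrite realV realX // normr_real.
by rewrite Re_conj mulr_gt0 // invr_gt0 exprn_gt0 // normr_gt0.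
Qed.

(* Along the recurrence the ratios [k Z(W - a) / Z(W)] stay in the open right half-plane. *)
Lemma mdZ_neq0 (k : C) (W : {set gV G}) : 0 < 'Re k ->
  mdZ (fun _ : gE G => k ^+ 2) (fun=> 1) W != 0.
Proof.
move=> k0; set Z := mdZ _ _.
have nk : k != 0 by apply: contraTneq k0 => ->; rewrite raddf0 ltxx.
suff [] : Z W != 0 /\ forall a, a \in W -> 0 < 'Re (k * Z (W :\ a) / Z W) by [].
have [m] := ubnP #|W|; elim: m W => // m IHm W cW.
have key a : a \in W -> Z W != 0 /\ 0 < 'Re (k * Z (W :\ a) / Z W).
  move=> aW; have cWa : (#|W :\ a| < m)%N.
    by move: cW; rewrite (cardsD1 a) aW.
  have [nZa ReZa] := IHm _ cWa.
  (* The inverse ratio is [k^-1] plus ratios for the smaller set [W :\ a]; the open right half-plane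
     is stable under sums and inverses. *)
  have ZW : Z W / (k * Z (W :\ a)) =
      k^-1 + \sum_(e | incident a e && (other e a \in W))
                k * Z (W :\ a :\ other e a) / Z (W :\ a).
    rewrite /Z (mdZ_rec loopG _ _ aW) -/Z mul1r mulrDl; congr (_ + _).
      by field; rewrite nk nZa.
    rewrite mulr_suml; apply: eq_bigr => e _.
    by field; rewrite nk nZa.
  have ReZ : 0 < 'Re (Z W / (k * Z (W :\ a))).
    rewrite ZW raddfD /= ltr_pwDl ?Re_inv_gt0 // raddf_sum sumr_ge0 // => e /andP[ae cWe].
    by apply/ltW/ReZa; rewrite !inE cWe andbT other_neq.
  have nZ : Z W != 0 by apply: contraTneq ReZ => ->; rewrite mul0r raddf0 ltxx.
  by split=> //; have := Re_inv_gt0 ReZ; rewrite invf_div.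
have [->|[a aW]] := set_0Vmem W.
  by split=> [|a]; [rewrite /Z mdZ_set0 oner_eq0 | rewrite inE].
by split=> [|b /key[]//]; case: (key a aW).
Qed.

(** A square root of [z] has real part 0, for otherwise it or its opposite contradicts [mdZ_neq0].
    Hence [z] is real and at most 0, and the constant term 1 excludes 0. *)
Lemma mdZ_root_lt0 (z : C) : mdZ (fun _ : gE G => z) (fun=> 1) setT = 0 -> z < 0.
Proof.
move=> Z0; have zE : sqrtC z ^+ 2 = z by rewrite sqrtCK.
have Zk k : 0 < 'Re k -> k ^+ 2 <> z.
  by move=> k0 kz; have := mdZ_neq0 setT k0; rewrite kz Z0 eqxx.
have nz : z != 0.
  apply/eqP => z0; move: Z0; rewrite z0 mdZ_const big_ord_recl mcount0 expr0 mulr1.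
  rewrite big1 => [|i _]; first by rewrite addr0 => /eqP; rewrite oner_eq0.
  by rewrite expr0n mulr0.
have /orP[/orP[/eqP Re0|Rep]|Ren] :
    ('Re (sqrtC z) == 0) || (0 < 'Re (sqrtC z)) || ('Re (sqrtC z) < 0).
  have := Creal_Re (sqrtC z); rewrite realE lt_def lt_neqAle.
  by case: eqP => //= _ /orP[] ->; rewrite ?orbT.
- move: zE; rewrite (Crect (sqrtC z)) Re0 add0r exprMn sqrCi mulN1r => zE.
  rewrite lt_neqAle nz -zE oppr_le0 /=.
  by rewrite real_exprn_even_ge0 // Creal_Im.
- by case: (Zk _ Rep).
- by case: (Zk (- sqrtC z)); rewrite ?raddfN ?oppr_gt0 ?sqrrN.
Qed.

End HeilmannLieb.

Section RealRooted.
Variables (G : mgraph) (R : realType).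
Hypothesis loopG : loopless G.

Definition mgen_poly : {poly R} := \poly_(k < (nu G).+1) (mcount G k)%:R.

Lemma size_mgen_poly : size mgen_poly = (nu G).+1.
Proof. by rewrite size_poly_eq // pnatr_eq0 -lt0n mcount_nu_gt0. Qed.

(** The polynomial splits over [R[i]], where all its roots are negative reals; the factorisation
    descends because the embedding of [R] is injective on polynomials. *)
Lemma mgen_poly_split : exists2 s : seq R, all (fun a => 0 < a) s &
  mgen_poly = lead_coef mgen_poly *: \prod_(a <- s) ('X + a%:P).
Proof.
pose f : {rmorphism R -> R[i]%C} := real_complex R; pose q := map_poly f mgen_poly.
have qE : q = \poly_(k < (nu G).+1) (mcount G k)%:R.
  by apply/polyP => i; rewrite coef_map !coef_poly; case: ifP => _;
     [apply: rmorph_nat|apply: rmorph0].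
have qh z : q.[z] = mdZ (fun _ : gE G => z) (fun=> 1) setT.
  by rewrite mdZ_const qE horner_poly.
have [r rE] := closed_field_poly_normal q.
have lq : lead_coef q = f (lead_coef mgen_poly) by rewrite lead_coef_map.
have r0 z : z \in r -> z < 0.
  move=> zr; apply: (@mdZ_root_lt0 G _ loopG); rewrite -qh rE hornerZ.
  by rewrite horner_prod (big_rem z) //= hornerXsubC subrr mul0r mulr0.
exists [seq - complex.Re z | z <- r].
  apply/allP => _ /mapP[z zr ->]; move: (r0 z zr).
  (* In the order of [R[i]], [z < 0] includes that the imaginary part vanishes. *)
  by rewrite ltcE /= => /andP[_ z0]; rewrite oppr_gt0.
apply: (map_poly_inj f); rewrite -/q rE lq map_polyZ rmorph_prod big_map; congr (_ *: _).
apply: eq_big_seq => z /r0; rewrite ltcE /= => /andP[/eqP z0 _].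
rewrite rmorphD /= map_polyX map_polyC -polyCN; congr (_ + _%:P).
by case: z z0 => a b /= <-; apply/eqP; rewrite eq_complex /= oppr0 !eqxx.
Qed.

End RealRooted.

Section Newton.
Variable R : realType.

(* [newtonE s k] is the [k]-th coefficient of [\prod_(a <- s) ('X + a%:P)] divided
   by ['C(size s, k)]. *)
Fixpoint newtonE (s : seq R) (k : nat) : R :=
  if s is a :: s' then
    (k%:R * newtonE s' k.-1 + (size s - k)%:R * a * newtonE s' k) / (size s)%:R
  else (k == 0)%N%:R.

Lemma coef_prod_newtonE (s : seq R) (k : nat) :
  (\prod_(a <- s) ('X + a%:P))`_k = 'C(size s, k)%:R * newtonE s k.
Proof.
elim: s k => [|a s IHs] k.
  by rewrite big_nil coef1 bin0n /=; case: k => [|k]; rewrite ?mulr1 ?mulr0.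
rewrite big_cons mulrDl coefD coefXM coefCM !IHs /=.
set n := size s.
have n0 : n.+1%:R != 0 :> R by rewrite pnatr_eq0.
case: k => [|k] /=.
  by rewrite !bin0 mul0r add0r subn0; field; rewrite nat1r.
(* These absorption identities turn Pascal's rule into the weights of the recursion of [newtonE]. *)
have h1 : (k.+1 * 'C(n.+1, k.+1) = n.+1 * 'C(n, k))%N by rewrite -mul_bin_diag.
have h2 : ((n.+1 - k.+1) * 'C(n.+1, k.+1) = n.+1 * 'C(n, k.+1))%N.
  by rewrite -mul_bin_down.
have h1' : k.+1%:R * 'C(n.+1, k.+1)%:R = n.+1%:R * 'C(n, k)%:R :> R by rewrite -!natrM h1.
have h2' : (n.+1 - k.+1)%:R * 'C(n.+1, k.+1)%:R = n.+1%:R * 'C(n, k.+1)%:R :> R.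
  by rewrite -!natrM h2.
have -> : 'C(n.+1, k.+1)%:R * ((k.+1%:R * newtonE s k
     + (n.+1 - k.+1)%:R * a * newtonE s k.+1) / n.+1%:R)
  = ((k.+1%:R * 'C(n.+1, k.+1)%:R) * newtonE s k
     + ((n.+1 - k.+1)%:R * 'C(n.+1, k.+1)%:R) * a * newtonE s k.+1) / n.+1%:R :> R.
  by field; rewrite nat1r.
by rewrite h1' h2'; field; rewrite nat1r.
Qed.

(** [p, q, r, t] stand for the values of [newtonE s] at [k - 1, ..., k + 2], with [J = k] and
    [d = size s - k - 1]. The difference of the two sides is a nonnegative combination of the three
    hypotheses plus the square of [q - a * r]. The factor [J] voids the hypotheses on [p] at
    [k = 0], where there is no previous value. *)
Lemma newton_step (J d a p q r t : R) : 0 <= J -> 0 <= d -> 0 <= a ->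
  0 <= q -> 0 <= r ->
  J * (p * r) <= J * (q * q) -> q * t <= r * r -> J * (p * t) <= J * (q * r) ->
  (J * p + (d + 2) * a * q) * ((J + 2) * r + d * a * t)
    <= ((J + 1) * q + (d + 1) * a * r) ^+ 2.
Proof.
move=> J0 d0 a0 q0 r0 h1 h2 h3.
have k1 : (J + 2) * (J * (p * r)) <= (J + 2) * (J * (q * q)) by rewrite ler_wpM2l //; lra.
have k2 : d * (d + 2) * (a * a) * (q * t) <= d * (d + 2) * (a * a) * (r * r).
  by rewrite ler_wpM2l // !mulr_ge0 //; lra.
have k3 : d * a * (J * (p * t)) <= d * a * (J * (q * r)).
  by rewrite ler_wpM2l // mulr_ge0.
have k4 := sqr_ge0 (q - a * r).
rewrite -subr_ge0 in k1; rewrite -subr_ge0 in k2; rewrite -subr_ge0 in k3.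
rewrite -subr_ge0; have := addr_ge0 (addr_ge0 k1 k2) (addr_ge0 k3 k4).
by congr (0 <= _); ring.
Qed.

Lemma newtonE_logconcave (s : seq R) : all (fun a => 0 < a) s ->
  [/\ forall k, (k <= size s)%N -> 0 < newtonE s k,
      forall k, (size s < k)%N -> newtonE s k = 0
    & forall k, newtonE s k * newtonE s k.+2 <= newtonE s k.+1 ^+ 2].
Proof.
elim: s => [_|a s IHs /andP[a0 /IHs[IHp IHz IHl]]].
  split=> [[|k]|[|k]|k] //=; try by rewrite ltr0n.
  by rewrite mulr0 expr0n.
rewrite [newtonE _]lock; set n := size s in IHp IHz *.
have E' k : locked (newtonE (a :: s)) k =
    (k%:R * newtonE s k.-1 + (n.+1 - k)%:R * a * newtonE s k) / n.+1%:R.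
  by rewrite -lock.
have z k : (n.+1 < k)%N -> locked (newtonE (a :: s)) k = 0.
  move=> nk; have nk1 : (n < k.-1)%N by rewrite -ltnS prednK // (leq_trans _ nk).
  by rewrite E' IHz // IHz ?(ltnW nk) // !mulr0 addr0 mul0r.
split=> // k.
  move=> kn; rewrite E' divr_gt0 ?ltr0n //.
  have [k0|kp] := posnP k; first by rewrite k0 mul0r add0r subn0 !mulr_gt0 ?ltr0n ?IHp.
  rewrite ltr_wpDr ?mulr_gt0 ?ltr0n ?IHp //; last by rewrite -ltnS prednK.
  rewrite mulr_ge0 ?mulr_ge0 ?ler0n ?(ltW a0) //.
  by have [/IHp/ltW//|/IHz->] := leqP k n.
have [kn|nk] := ltnP n.+1 k.+2; first by rewrite (z _ kn) mulr0 sqr_ge0.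
have [d nE] : exists d, n = (k.+1 + d)%N by exists (n - k.+1)%N; rewrite subnKC.
rewrite !E' [leRHS]expr_div_n mulf_div -expr2 ler_wpM2r ?invr_ge0 ?sqr_ge0 //.
have -> : (n.+1 - k)%:R = d%:R + 2 :> R by
  rewrite nE (_ : ((k.+1 + d).+1 - k = d + 2)%N) ?natrD //; lia.
have -> : (n.+1 - k.+1)%:R = d%:R + 1 :> R by
  rewrite nE (_ : ((k.+1 + d).+1 - k.+1 = d + 1)%N) ?natrD //; lia.
have -> : (n.+1 - k.+2)%:R = d%:R :> R by rewrite nE; congr _%:R; lia.
have -> : k.+2%:R = k%:R + 2 :> R by rewrite -addn2 natrD.
have -> : k.+1%:R = k%:R + 1 :> R by rewrite -addn1 natrD.
have q0 : 0 < newtonE s k by apply: IHp; lia.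
have r0 : 0 < newtonE s k.+1 by apply: IHp; lia.
have tE : newtonE s k * newtonE s k.+2 <= newtonE s k.+1 * newtonE s k.+1 by rewrite -expr2.
apply: newton_step; rewrite ?ler0n ?(ltW a0) ?(ltW q0) ?(ltW r0) //=.
  case: k {nE nk} q0 r0 tE => [|k] q0 r0 tE; first by rewrite !mul0r.
  by rewrite ler_wpM2l ?ler0n // -expr2.
case: k {nE nk} q0 r0 tE => [|k] q0 r0 tE; first by rewrite !mul0r.
rewrite ler_wpM2l ?ler0n //=; set p := newtonE s k.
(* The inequality between outer and inner products is the product of two log-concavity inequalities,
   divided by the product of the inner values. *)
rewrite -(ler_pM2r (mulr_gt0 q0 r0)).
have -> : p * newtonE s k.+3 * (newtonE s k.+1 * newtonE s k.+2)
   = (p * newtonE s k.+2) * (newtonE s k.+1 * newtonE s k.+3) by ring.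
have p0 : 0 <= p.
  by rewrite /p; have [/IHp/ltW//|/IHz->] := leqP k n.
have t0 : 0 <= newtonE s k.+3.
  by have [/IHp/ltW//|/IHz->] := leqP k.+3 n.
apply: le_trans (_ : (newtonE s k.+1 ^+ 2) * (newtonE s k.+2 ^+ 2) <= _).
  by apply: ler_pM (IHl k) (IHl k.+1); rewrite mulr_ge0 // ltW.
by rewrite le_eqVlt; apply/orP; left; apply/eqP; ring.
Qed.

End Newton.

Section SupportingLine.
Variables (R : realType) (n : nat) (E : nat -> R).
Hypothesis E_gt0 : forall k, (k <= n)%N -> 0 < E k.
Hypothesis E_eq0 : forall k, (n < k)%N -> E k = 0.
Hypothesis E_logconcave : forall k, E k * E k.+2 <= E k.+1 ^+ 2.

(** A supporting line of [ln E] at [k] in multiplicative form. Its slope is the ratio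
    [r = E k.+1 / E k]: by log-concavity successive ratios are at most [r] above [k] and at least
    [r] below. *)
Lemma logconcave_support k : (k < n)%N ->
  exists2 r, 0 < r & forall j, (j <= n)%N -> E j * r ^+ k <= E k * r ^+ j.
Proof.
move=> kn; have Ek : 0 < E k by rewrite E_gt0 // ltnW.
have Ek1 : 0 < E k.+1 by rewrite E_gt0.
pose r := E k.+1 / E k; have r0 : 0 < r by rewrite divr_gt0.
have rE : E k.+1 = r * E k by rewrite /r divfK // gt_eqF.
clearbody r; exists r => // j jn.
have up d : E (k + d.+1)%N <= r * E (k + d)%N.
  elim: d => [|d IHd]; first by rewrite addn1 addn0 rE.
  rewrite !addnS in IHd *; have [kd|kd] := leqP (k + d) n; last first.
    by rewrite !E_eq0 ?mulr0 //; lia.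
  have Ekd := E_gt0 kd; rewrite -(ler_pM2l Ekd); apply: le_trans (E_logconcave _) _.
  rewrite expr2 mulrCA mulrA; have [kd1|kd1] := leqP (k + d).+1 n.
    by rewrite ler_wpM2r // ltW // E_gt0.
  by rewrite !(E_eq0 kd1) !mulr0.
have down d : (d <= k)%N -> r * E (k - d)%N <= E (k - d).+1.
  elim: d => [_|d IHd dk]; first by rewrite subn0 rE.
  have := IHd (ltnW dk); have -> : (k - d = (k - d.+1).+1)%N by lia.
  set i := (k - d.+1)%N => h; have Ei1 : 0 < E i.+1 by apply: E_gt0; lia.
  have Ei : 0 < E i by apply: E_gt0; lia.
  rewrite -(ler_pM2l Ei1) -[leRHS]expr2; apply: le_trans (E_logconcave i).
  by rewrite mulrA mulrC ler_wpM2l ?(ltW Ei) // mulrC.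
have [kj|jk] := leqP k j.
  have -> : j = (k + (j - k))%N by lia.
  rewrite exprD mulrCA mulrC ler_wpM2l ?exprn_ge0 ?(ltW r0) //.
  elim: (j - k)%N => [|d IHd]; first by rewrite addn0 mulr1.
  apply: le_trans (up d) _; rewrite exprS [leRHS]mulrCA ler_wpM2l ?(ltW r0) //.
have dk : (k - j <= k)%N by lia.
rewrite [r ^+ k](_ : _ = r ^+ j * r ^+ (k - j)); last first.
  by rewrite -exprD; congr (_ ^+ _); lia.
have -> : E j = E (k - (k - j))%N by congr E; lia.
rewrite mulrCA [leRHS]mulrC ler_wpM2l ?exprn_ge0 ?(ltW r0) //.
elim: (k - j)%N dk => [|d IHd] dk; first by rewrite subn0 mulr1.
apply: le_trans (IHd (ltnW dk)); rewrite exprS mulrA ler_wpM2r ?exprn_ge0 ?(ltW r0) //.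
rewrite mulrC; apply: le_trans (down _ dk) _.
by have -> : ((k - d.+1).+1 = k - d)%N by lia.
Qed.

End SupportingLine.

(** * Matchings of fixed size *)

Section MatchingsOfSizeK.
Variables (G : mgraph) (R : realType).
Hypothesis bipG : bipartite G.

Lemma in_hull_k_sum k (x : gE G -> R) :
  in_matching_polytope_k G k x -> \sum_e x e = k%:R.
Proof.
move=> [lam [_ lamP lam1 xE]]; rewrite (eq_bigr _ (fun e _ => xE e)) exchange_big /=.
have -> : k%:R = \sum_B k%:R * lam B by rewrite -mulr_sumr lam1 mulr1.
apply: eq_bigr => B _.
have [/andP[_ /eqP <-]|/lamP->] := boolP (is_matching B && (#|B| == k)); last first.
  by rewrite mulr0 big1 // => e; rewrite mul0r.
rewrite -mulr_sumr mulrC /incvec -natr_sum -sum1_card [in RHS]big_mkcond /=.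
by congr (_%:R * _); apply: eq_bigr => e _; case: (e \in B).
Qed.

(** The coordinates of a point of [M_k] sum to [k], so the linear term of the lower bound is
    [k * ln z] and exponentiates to a power of [z]. *)
Lemma expR_bethe_le k (x : gE G -> R) z : in_matching_polytope_k G k x -> 0 < z ->
  z ^+ k * expR (bethe_entropy G x) <= matching_poly G z.
Proof.
move=> xk z0; have fx : fractional_matching x.
  by apply: in_hull_fractional xk => B /andP[].
have := matching_poly_ge bipG fx z0; rewrite /bethe_free (in_hull_k_sum xk).
have P0 : 0 < matching_poly G z.
  rewrite matching_polyE; apply: mdZ_gt0 => // [|e]; last exact: ltW.
  exact: bipartite_loopless.
by rewrite -ler_expR expRD lnK ?posrE // expRM_natl lnK ?posrE.
Qed.

Lemma matching_poly_newton : exists E : nat -> R,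
  [/\ forall k, (k <= nu G)%N -> 0 < E k, forall k, (nu G < k)%N -> E k = 0,
      forall k, E k * E k.+2 <= E k.+1 ^+ 2
    & forall k, (k <= nu G)%N -> (mcount G k)%:R = 'C(nu G, k)%:R * E k].
Proof.
have [s s0 sE] := mgen_poly_split R (bipartite_loopless bipG).
have l0 : 0 < lead_coef (mgen_poly G R).
  by rewrite lead_coefE size_mgen_poly coef_poly ltnSn ltr0n mcount_nu_gt0.
have szs : size s = nu G.
  have := size_mgen_poly G R; rewrite sE size_scale ?gt_eqF //.
  rewrite (eq_bigr (fun a => 'X - (- a)%:P)) => [|a _]; last by rewrite polyCN opprK.
  by rewrite size_prod_XsubC => -[].
have [Ep Ez El] := newtonE_logconcave s0; rewrite szs in Ep Ez.
exists (fun k => lead_coef (mgen_poly G R) * newtonE s k); split => k.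
- by move=> kn; rewrite mulr_gt0 ?Ep.
- by move=> kn; rewrite Ez ?mulr0.
- by rewrite mulrACA exprMn -expr2 ler_wpM2l ?sqr_ge0.
- move=> kn; have := congr1 (fun p : {poly R} => p`_k) sE; rewrite coefZ coef_poly ltnS kn => ->.
  by rewrite coef_prod_newtonE szs mulrCA.
Qed.

Lemma mcount_ge k (x : gE G -> R) : (k <= nu G)%N -> in_matching_polytope_k G k x ->
  binom_pmf (nu G) k (k%:R / (nu G)%:R) * expR (bethe_entropy G x) <= (mcount G k)%:R.
Proof.
move=> kn xk; set n := nu G in kn *; set S := expR _.
have PS z : 0 < z -> z ^+ k * S <= matching_poly G z by apply: expR_bethe_le.
have zX j (t : R) : 0 < t -> t <= 1 -> t ^+ j.+1 <= t.
  by move=> t0 t1; rewrite exprS ler_piMr ?exprn_ile1 // ltW.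
(* Here the binomial factor is 1, even when [nu G = 0], as division by 0 yields 0. Letting [z] tend
   to 0 leaves the constant coefficient. *)
have [k0|kp] := posnP k.
  rewrite k0 /binom_pmf bin0 expr0 mul0r subr0 expr1n !mul1r mcount0.
  apply: (@ler_of_linear _ _ (\sum_(j < n) (mcount G (bump 0 j))%:R)) => t t0 t1.
  have := PS t t0; rewrite k0 expr0 mul1r => /le_trans; apply.
  rewrite /matching_poly big_ord_recl mcount0 expr0 mulr1 lerD2l mulr_sumr.
  by apply: ler_sum => j _; rewrite mulrC ler_wpM2r ?ler0n //; apply: zX.
have n0 : n%:R != 0 :> R by rewrite pnatr_eq0; lia.
(* The binomial factor is again 1, and [z = t^-1] tends to infinity, leaving the top coefficient. *)
have [kE|kn'] := eqVneq k n.
  rewrite kE /binom_pmf binn divff // expr1n subnn expr0 !mul1r.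
  apply: (@ler_of_linear _ _ (\sum_(j < n) (mcount G j)%:R)) => t t0 t1.
  have ti0 : 0 < t^-1 by rewrite invr_gt0.
  have := PS _ ti0; rewrite kE exprVn mulrC ler_pdivrMr ?exprn_gt0 // => /le_trans; apply.
  rewrite /matching_poly big_ord_recr /= -/n mulrDl addrC exprVn divfK; last first.
    by rewrite expf_neq0 // gt_eqF.
  rewrite lerD2l mulr_suml mulr_sumr; apply: ler_sum => j _.
  rewrite -mulrA mulrC ler_wpM2r ?ler0n // exprVn.
  have jn := ltn_ord j.
  rewrite [t ^+ n](_ : _ = t ^+ j * t ^+ (n - j.+1).+1); last first.
    by rewrite -exprD; congr (_ ^+ _); lia.
  by rewrite mulKf ?zX // expf_neq0 // gt_eqF.
have {kn'}kn : (k < n)%N by rewrite ltn_neqAle kn'.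
have [E [Ep Ez El mE]] := matching_poly_newton; rewrite -/n in Ep Ez mE.
have [r r0 sup] := logconcave_support Ep Ez El kn.
have nk0 : 0 < (n - k)%:R :> R by rewrite ltr0n subn_gt0.
have kp0 : 0 < k%:R :> R by rewrite ltr0n.
have nkE : (n - k)%:R = n%:R - k%:R :> R by rewrite natrB // ltnW.
(* [t] is the odds of the probability [k / n], so [(1 - k / n) * (1 + t) = 1]; then [z] is chosen
   with [r * z = t]. *)
have [t t0 tE] : exists2 t : R, 0 < t & t = k%:R / (n - k)%:R.
  by exists (k%:R / (n - k)%:R); rewrite ?divr_gt0.
have [z z0 rz] : exists2 z : R, 0 < z & r * z = t.
  by exists (t / r); rewrite ?divr_gt0 // mulrC divfK // gt_eqF.
(* The supporting line bounds each coefficient, and the binomial theorem sums the bounds. *)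
have Pz : matching_poly G z * r ^+ k <= E k * (1 + t) ^+ n.
  rewrite exprDn /matching_poly mulr_suml mulr_sumr ler_sum // => j _.
  have jn : (j <= n)%N by rewrite -ltnS.
  rewrite expr1n mul1r mE // -rz exprMn -[(r ^+ _ * _) *+ _]mulr_natr.
  have -> : 'C(n, j)%:R * E j * z ^+ j * r ^+ k = ('C(n, j)%:R * z ^+ j) * (E j * r ^+ k) by ring.
  have -> : E k * (r ^+ j * z ^+ j * 'C(n, j)%:R) = ('C(n, j)%:R * z ^+ j) * (E k * r ^+ j) by ring.
  by rewrite ler_wpM2l ?sup // mulr_ge0 ?ler0n ?exprn_ge0 ?(ltW z0).
have tk : t ^+ k * S <= E k * (1 + t) ^+ n.
  apply: le_trans Pz; rewrite -rz exprMn -mulrA mulrC ler_wpM2r ?exprn_ge0 ?(ltW r0) //.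
  exact: PS.
have qE : 1 - k%:R / n%:R = (n - k)%:R / n%:R :> R by rewrite nkE; field.
have pE : k%:R / n%:R = t * (1 - k%:R / n%:R) by rewrite qE tE; field; rewrite n0 gt_eqF.
have qt : (1 - k%:R / n%:R) * (1 + t) = 1 by rewrite qE tE nkE; field; rewrite n0 -nkE gt_eqF.
rewrite (mE k (ltnW kn)) /binom_pmf; set q := 1 - k%:R / n%:R in pE qt qE *.
have q0 : 0 < q by rewrite qE divr_gt0 // ltr0n; lia.
rewrite -!mulrA ler_wpM2l ?ler0n // pE exprMn.
have -> : t ^+ k * q ^+ k * (q ^+ (n - k) * S) = q ^+ n * (t ^+ k * S).
  have -> : q ^+ n = q ^+ k * q ^+ (n - k) by rewrite -exprD subnKC // ltnW.
  by rewrite -!mulrA mulrCA; congr (_ * _); rewrite mulrCA.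
have -> : E k = q ^+ n * (E k * (1 + t) ^+ n).
  by rewrite mulrCA -exprMn qt expr1n mulr1.
by rewrite ler_wpM2l // exprn_ge0 // ltW.
Qed.

End MatchingsOfSizeK.

(** * Integrality of the bipartite matching polytope *)

Section Birkhoff.
Variables (G : mgraph) (R : realType).
Implicit Types (x d : gE G -> R) (e : gE G) (v : gV G).

Lemma in_hull_convex (P : {set gE G} -> bool) x y t : 0 <= t -> t <= 1 ->
  in_hull P x -> in_hull P y -> in_hull P (fun e => t * x e + (1 - t) * y e).
Proof.
move=> t0 t1 [l [l0 lP l1 lE]] [m [m0 mP m1 mE]].
have t1' : 0 <= 1 - t by rewrite subr_ge0.
exists (fun B => t * l B + (1 - t) * m B); split=> [B|B PB||e].
- by rewrite addr_ge0 // mulr_ge0.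
- by rewrite lP // mP // !mulr0 addr0.
- by rewrite big_split /= -!mulr_sumr l1 m1 !mulr1 addrC subrK.
- rewrite lE mE !mulr_sumr -big_split /=; apply: eq_bigr => B _.
  by ring.
Qed.

Lemma in_hull_incvec (P : {set gE G} -> bool) (B : {set gE G}) : P B -> in_hull P (incvec R B).
Proof.
move=> PB; exists (fun B' => (B' == B)%:R); split=> [B'|B' PB'||e].
- exact: ler0n.
- by case: eqP PB' => // ->; rewrite PB.
- by rewrite (bigD1 B) //= eqxx big1 ?addr0 // => B' /negPf->.
- rewrite (bigD1 B) //= eqxx mul1r big1 ?addr0 // => B' /negPf->.
  by rewrite mul0r.
Qed.

Lemma eq_in_hull (P : {set gE G} -> bool) x y : x =1 y -> in_hull P x -> in_hull P y.
Proof. by move=> xy [l [? ? ? lE]]; exists l; split=> // e; rewrite -xy. Qed.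

(* The slacks of the inequalities [0 <= x e] and [\sum_(e at v) x e <= 1]. *)
Definition slack x (i : gE G + gV G) : R :=
  match i with inl e => x e | inr v => 1 - \sum_(e | incident v e) x e end.

Definition rate d (i : gE G + gV G) : R :=
  match i with inl e => d e | inr v => - \sum_(e | incident v e) d e end.

Lemma slack_move x d t i : slack (fun e => x e + t * d e) i = slack x i + t * rate d i.
Proof.
case: i => [e|v] //=; rewrite big_split /= -mulr_sumr mulrN opprD addrA //.
Qed.

Lemma fractional_slack x : fractional_matching x <-> forall i, 0 <= slack x i.
Proof.
split=> [[x0 x1] [e|v]|h] /=; [exact: x0|by rewrite subr_ge0|].
by split=> [e|v]; [exact: (h (inl e))|have := h (inr v); rewrite /= subr_ge0].
Qed.

Definition tight x := [set i | slack x i == 0].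

(** The ratio test of linear programming: move along [d] until a first slack reaches 0. Tight
    constraints have rate 0 and stay tight, and the blocking one is new. *)
Lemma move_to_tighter x d : fractional_matching x -> (exists e, d e != 0) ->
  (forall i, slack x i = 0 -> rate d i = 0) ->
  exists2 t : R, 0 < t & fractional_matching (fun e => x e + t * d e)
    /\ (#|tight x| < #|tight (fun e => x e + t * d e)%R|)%N.
Proof.
move=> /fractional_slack fx [e0 de0] dt.
(* If no rate were negative, [d] would be nonnegative with nonpositive sums at the vertices, hence
   0. *)
have [i0 ri0] : exists i, rate d i < 0.
  suff /existsP : [exists i, rate d i < 0] by [].
  apply: contraNT de0 => /existsPn h; have hr i : 0 <= rate d i by rewrite leNgt h.
  have d0 e : 0 <= d e := hr (inl e).
  rewrite eq_le d0 andbT; have := hr (inr (gends e0).1); rewrite /= oppr_ge0.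
  by apply: le_trans; rewrite (bigD1 e0) ?incident_l //= lerDl sumr_ge0.
pose ratio i := slack x i / - rate d i.
case: (@arg_minP _ _ _ i0 (fun i => rate d i < 0) ratio ri0) => i ri imin.
have s0 : 0 < slack x i.
  rewrite lt_def fx andbT; apply: contraTneq ri => /dt ->; by rewrite ltxx.
have t0 : 0 < ratio i by rewrite divr_gt0 ?oppr_gt0.
exists (ratio i) => //; split.
  apply/fractional_slack => j; rewrite slack_move.
  have [rj|rj] := ltP (rate d j) 0; last by rewrite addr_ge0 ?fx // mulr_ge0 // ltW.
  have := imin j rj; rewrite {2}/ratio ler_pdivlMr ?oppr_gt0 // mulrN; lra.
apply: proper_card; apply/properP; split.
  apply/fintype.subsetP => j; rewrite !inE => /eqP sj.
  by rewrite slack_move sj (dt _ sj) mulr0 addr0.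
exists i; rewrite inE; last by rewrite gt_eqF.
by rewrite slack_move /ratio invrN mulrN mulNr divfK ?subrr // lt_eqF.
Qed.

Hypothesis bipG : bipartite G.
Let loopG := bipartite_loopless bipG.

Definition interior x := [set e | 0 < x e < 1].
Definition tight_interior x :=
  [set v | (\sum_(e | incident v e) x e == 1) && [exists e in interior x, incident v e]].

(** One fractional term cannot make a sum of 1 by itself, and any further positive term is
    fractional too. *)
Lemma tight_interior_degree x v : fractional_matching x -> v \in tight_interior x ->
  (2 <= #|[set e in interior x | incident v e]|)%N.
Proof.
move=> [x0 x1]; rewrite inE => /andP[/eqP sv /exists_inP[e eI ve]].
have := eI; rewrite inE => /andP[xe0 xe1].
have rest : \sum_(f | incident v f && (f != e)) x f = 1 - x e.
  by rewrite -sv [in RHS](bigD1 e) //= addrC addrK.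
have [f /andP[vf fe] xf] : exists2 f, incident v f && (f != e) & 0 < x f.
  suff /exists_inP : [exists (f | incident v f && (f != e)), 0 < x f] by [].
  apply: contraLR xe1 => /exists_inPn h; rewrite -leNgt -subr_le0 -rest.
  by rewrite sumr_le0 // => f vf; rewrite leNgt h.
have fI : f \in interior x.
  rewrite inE xf /=; suff : x f <= 1 - x e by move=> h; apply: le_lt_trans h _; lra.
  rewrite -rest (bigD1 f) ?vf //= lerDl sumr_ge0 //.
rewrite (cardsD1 e) inE eI ve /= ltnS; apply/card_gt0P; exists f.
by rewrite in_setD1 fe inE fI vf.
Qed.

(** The direction is a left kernel vector of the incidence matrix [A] of fractional edges against
    tight vertices. Were the rows free, counting degrees would make [A] square, with both ends of
    every fractional edge tight; but then the sign vector of the two colour classes is a nonzero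
    vector killed by an invertible matrix. *)
Lemma exists_direction x : fractional_matching x -> interior x != set0 ->
  exists d, (exists e, d e != 0) /\ forall i, slack x i = 0 -> rate d i = 0.
Proof.
move=> fx /set0Pn[e1 e1I]; set F := interior x; set T := tight_interior x.
pose A := \matrix_(i < #|F|, j < #|T|) ((incident (enum_val j) (enum_val i))%:R : R).
have nfree : ~~ row_free A.
  apply/negP => /eqP rA.
  have FT : (#|F| <= #|T|)%N by rewrite -rA rank_leq_col.
  pose deg v := #|[set e in F | incident v e]|.
  have degF : (\sum_v deg v = 2 * #|F|)%N.
    rewrite (eq_bigr (fun v => \sum_(e | incident v e) (e \in F : nat))%N) => [|v _]; last first.
      rewrite /deg -sum1_card big_mkcond [RHS]big_mkcond /=; apply: eq_bigr => e _.
      by rewrite inE andbC; case: (incident v e); case: (e \in F).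
    rewrite (big_incident_ends loopG (fun e _ => (e \in F : nat))) /= -sum1_card big_distrr /=.
    by rewrite [RHS]big_mkcond /=; apply: eq_bigr => e _; case: (e \in F).
  have degT : (2 * #|T| <= \sum_(v in T) deg v)%N.
    rewrite mulnC -sum_nat_const; apply: leq_sum => v vT.
    exact: tight_interior_degree.
  have degS : (\sum_v deg v = \sum_(v in T) deg v + \sum_(v | v \notin T) deg v)%N.
    by rewrite (bigID (mem T)).
  have TF : #|T| = #|F| by lia.
  have out0 : (\sum_(v | v \notin T) deg v = 0)%N by lia.
  have endT e v : e \in F -> incident v e -> v \in T.
    move=> eF ve; apply: contraTT isT => vT; move/eqP: out0.
    rewrite sum_nat_eq0 => /forallP/(_ v); rewrite vT /= cards_eq0 => /eqP/setP/(_ e).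
    by rewrite inE eF ve in_set0.
  have [c hc] := bipG.
  have /row_fullP[B BA] : row_full A by rewrite /row_full rA TF.
  pose s := \col_(j < #|T|) ((-1) ^+ c (enum_val j) : R).
  have As : A *m s = 0.
    apply/colP => i; rewrite !mxE; set e := enum_val i.
    rewrite (eq_bigr (fun j : 'I_#|T| => (fun v => (incident v e)%:R * (-1) ^+ c v) (enum_val j)))
      => [|j _]; last by rewrite !mxE.
    rewrite -(big_enum_val (fun v => (incident v e)%:R * (-1) ^+ c v)) /=.
    have eF : e \in F by apply: enum_valP.
    rewrite big_mkcond /= (bigD1 (gends e).1) //= (bigD1 (gends e).2) /=; last first.
      by rewrite eq_sym loopG.
    rewrite !(endT e) ?incident_l ?incident_r // big1 => [|v /andP[v1 v2]].
      by rewrite !mul1r addr0; move: (hc e); case: (c _); case: (c _) => //= _;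
         rewrite expr1 expr0 ?addNr ?subrr.
    by case: ifP => // _; rewrite /incident eq_sym (negPf v1) eq_sym (negPf v2) mul0r.
  have s0 : s = 0 by rewrite -[s]mul1mx -BA -mulmxA As mulmx0.
  have aT : (gends e1).1 \in T by apply: (endT e1); rewrite ?incident_l.
  have := congr1 (fun M : 'cV_#|T| => M (enum_rank_in aT (gends e1).1) 0) s0.
  by rewrite !mxE => /eqP; rewrite signr_eq0.
have : kermx A != 0 by rewrite kermx_eq0.
case/rowV0Pn => u /sub_kermxP uA u0.
pose d e := \sum_i u 0 i * (enum_val i == e)%:R.
have dE i : d (enum_val i) = u 0 i.
  rewrite /d (bigD1 i) //= eqxx mulr1 big1 ?addr0 // => j ji.
  by rewrite (inj_eq enum_val_inj) (negPf ji) mulr0.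
have dF e : e \notin F -> d e = 0.
  move=> eF; rewrite /d big1 // => i _; case: eqP => [ie|]; last by rewrite mulr0.
  by move: eF; rewrite -ie enum_valP.
exists d; split.
  have [i ui] : exists i, u 0 i != 0.
    apply/existsP; apply: contraNT u0 => /existsPn h; apply/eqP/rowP => i.
    by rewrite mxE; apply/eqP; have := h i; rewrite negbK.
  by exists (enum_val i); rewrite dE.
move=> [e|v] /= sl; first by rewrite dF // inE sl ltxx.
have {}sl : \sum_(e | incident v e) x e == 1 by rewrite eq_sym -subr_eq0 sl.
apply/eqP; rewrite oppr_eq0; apply/eqP.
have [vT|vT] := boolP (v \in T); last first.
  rewrite big1 // => e ve; apply: dF; apply: contra vT => eF.
  by rewrite inE sl /=; apply/exists_inP; exists e.
have uv := congr1 (fun M : 'rV_#|T| => M 0 (enum_rank_in vT v)) uA.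
rewrite !mxE in uv; rewrite -[RHS]uv.
rewrite /d exchange_big /=; apply: eq_bigr => i _; rewrite mxE enum_rankK_in // -mulr_sumr.
congr (_ * _); rewrite big_mkcond (bigD1 (enum_val i)) //= eqxx big1 ?addr0.
  by case: ifP.
by move=> e /negPf ei; rewrite eq_sym ei; case: ifP.
Qed.

(** Induction on the number of constraints that are not tight: a point with a fractional coordinate
    lies between the points where the moves along [d] and [- d] stop, and an integral point is an
    incidence vector. *)
Lemma fractional_matching_in_hull x : fractional_matching x -> in_hull (@is_matching G) x.
Proof.
have [m] := ubnP (#|{: gE G + gV G}| - #|tight x|); elim: m x => // m IHm x hm fx.
have [I0|I0] := eqVneq (interior x) set0.
  have x01 e : x e = (x e == 1)%:R.
    have := in_set0 e; rewrite -I0 inE.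
    have := fx.1 e; have := fractional_matching_le1 fx e.
    rewrite le_eqVlt => /orP[/eqP->|x1]; first by rewrite eqxx.
    rewrite le_eqVlt => /orP[/eqP<-|->]; last by rewrite x1.
    by rewrite [0 == 1]eq_sym oner_eq0.
  apply: (@eq_in_hull _ (incvec R [set e | x e == 1])).
    by move=> e; rewrite /incvec inE -x01.
  apply: in_hull_incvec; apply/forallP => v.
  have := fx.2 v; rewrite -(@ler_nat R); apply: le_trans.
  rewrite -sum1_card natr_sum big_mkcond [leRHS]big_mkcond /=; apply: ler_sum => e _.
  rewrite !inE (x01 e) andbC; case: (incident v e) => //=.
  by case: (x e == 1); rewrite ?eqxx //; case: ifP; rewrite /= ?ler01 // eq_sym oner_eq0.
have [d [d0 dt]] := exists_direction fx I0.
have [t t0 [ft tt]] := move_to_tighter fx d0 dt.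
have nd0 : exists e, - d e != 0 by case: d0 => e de; exists e; rewrite oppr_eq0.
have ndt i : slack x i = 0 -> rate (fun e => - d e) i = 0.
  move=> /dt; case: i => [e|v] /=; rewrite ?sumrN => h; first by rewrite h oppr0.
  by move: h => /eqP; rewrite oppr_eq0 => /eqP ->; rewrite !oppr0.
have [s s0 [fs ts]] := move_to_tighter fx nd0 ndt.
have tle (y : gE G -> R) : (#|tight y| <= #|{: gE G + gV G}|)%N by rewrite max_card.
have := tle (fun e => x e + t * d e); have := tle (fun e => x e + s * - d e) => h1 h2.
have ht : in_hull (@is_matching G) (fun e => x e + t * d e) by apply: IHm => //; lia.
have hs : in_hull (@is_matching G) (fun e => x e + s * - d e) by apply: IHm => //; lia.
have st : s + t != 0 by rewrite gt_eqF // addr_gt0.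
have c0 : 0 <= s / (s + t) by rewrite divr_ge0 ?addr_ge0 ?ltW.
have c1 : s / (s + t) <= 1 by rewrite ler_pdivrMr ?addr_gt0 // mul1r lerDl ltW.
apply: eq_in_hull (in_hull_convex c0 c1 ht hs) => e.
by field.
Qed.

End Birkhoff.

(** * Belief propagation *)

Lemma geometric_lt (R : realType) (C q eps : R) : 0 <= q -> q < 1 -> 0 < eps ->
  exists N, forall n, (N <= n)%N -> C * q ^+ n < eps.
Proof.
move=> q0 q1 eps0.
have [|N _ hN] := (@cvgrPdist_lt _ _ _ _ _ _ _).1 (@cvg_geometric R C q _) eps eps0.
  by rewrite ger0_norm.
exists N => n /hN; rewrite sub0r normrN => /(le_lt_trans (ler_norm _)).
by [].
Qed.

Section BeliefPropagation.
Variables (G : mgraph) (R : realType) (z : R) (D : nat).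
Hypothesis loopG : loopless G.
Hypothesis z_gt0 : 0 < z.
Implicit Types (m : gE G -> gV G -> R) (e : gE G) (v : gV G).

(* [m e v] is the message sent by [v] along its edge [e]. *)
Definition bp_step m e v : R :=
  (1 + z * \sum_(f | incident v f && (f != e)) m f (other f v))^-1.

Definition bp_fixpoint m : Prop := forall e v, incident v e ->
  0 < m e v /\ m e v = bp_step m e v.

Definition degree_le := forall v, (#|[set e | incident v e]| <= D)%N.

Definition bp_rate : R := z * D%:R / (1 + z * D%:R).

Lemma bp_denom_gt0 : 0 < 1 + z * D%:R.
Proof. by rewrite ltr_pwDl // mulr_ge0 ?ler0n ?(ltW z_gt0). Qed.

Lemma bp_rate_ge0 : 0 <= bp_rate.
Proof. by rewrite divr_ge0 ?(ltW bp_denom_gt0) // mulr_ge0 ?ler0n ?(ltW z_gt0). Qed.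

Lemma bp_rate_lt1 : bp_rate < 1.
Proof. by rewrite ltr_pdivrMr ?bp_denom_gt0 // mul1r ltrDr. Qed.

(* Closeness up to a factor [1 + c] is contracted since the incoming sum is at most [D]. *)
Lemma bp_contract (s s' c : R) : 0 <= s -> s <= D%:R -> 0 <= s' -> 0 <= c ->
  s' <= (1 + c) * s -> (1 + z * s)^-1 <= (1 + bp_rate * c) * (1 + z * s')^-1.
Proof.
move=> s0 sD s'0 c0 ss'.
have d0 : 0 < 1 + z * s by rewrite ltr_pwDl // mulr_ge0 ?(ltW z_gt0).
have d0' : 0 < 1 + z * s' by rewrite ltr_pwDl // mulr_ge0 ?(ltW z_gt0).
rewrite ler_pdivlMr // mulrC ler_pdivrMr //.
have h1 : 1 + z * s' <= (1 + z * s) + c * (z * s).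
  have : z * s' <= z * ((1 + c) * s) by rewrite ler_pM2l.
  lra.
apply: le_trans h1 _; rewrite mulrDl mul1r lerD2l mulrC [leRHS]mulrAC ler_wpM2r //.
rewrite /bp_rate mulrAC ler_pdivlMr ?bp_denom_gt0 //.
have : z * s <= z * D%:R by rewrite ler_pM2l.
lra.
Qed.

Lemma bp_step_gt0 m e v : (forall f u, incident u f -> 0 <= m f u) -> 0 < bp_step m e v.
Proof.
move=> m0; rewrite invr_gt0 ltr_pwDl // mulr_ge0 ?(ltW z_gt0) // sumr_ge0 // => f /andP[vf _].
exact/m0/incident_other.
Qed.

Lemma bp_step_le1 m e v : (forall f u, incident u f -> 0 <= m f u) -> bp_step m e v <= 1.
Proof.
move=> m0; rewrite invf_le1 ?lerDl ?ltr_pwDl // mulr_ge0 ?(ltW z_gt0) // sumr_ge0 //;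
  move=> f /andP[vf _]; exact/m0/incident_other.
Qed.

Lemma bp_step_anti m m' e v : (forall f u, incident u f -> 0 <= m f u) ->
  (forall f u, incident u f -> m f u <= m' f u) -> bp_step m' e v <= bp_step m e v.
Proof.
move=> m0 mm'; have h : 0 <= \sum_(f | incident v f && (f != e)) m f (other f v).
  by apply: sumr_ge0 => f _; apply/m0/incident_other.
have h' : \sum_(f | incident v f && (f != e)) m f (other f v)
    <= \sum_(f | incident v f && (f != e)) m' f (other f v).
  by apply: ler_sum => f _; apply/mm'/incident_other.
have h0 := le_trans h h'; rewrite /bp_step lef_pV2 ?posrE.
- by rewrite lerD2l ler_pM2l.
- by rewrite ltr_pwDl // mulr_ge0 // ltW.
- by rewrite ltr_pwDl // mulr_ge0 // ltW.
Qed.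

Hypothesis degD : degree_le.

Lemma sum_incident_leD m e v : (forall f u, incident u f -> m f u <= 1) ->
  \sum_(f | incident v f && (f != e)) m f (other f v) <= D%:R.
Proof.
move=> m1; apply: le_trans (_ : \sum_(f in [set f | incident v f]) 1 <= _); last first.
  by rewrite sumr_const ler_nat degD.
rewrite big_mkcond [leRHS]big_mkcond; apply: ler_sum => f _; rewrite inE.
case: (incident v f) => //=; case: ifP => // _; exact/m1/incident_other.
Qed.

Let iterm n := iter n bp_step (fun _ _ => 1).

Let iterm_bounds n e v : 0 < iterm n e v <= 1.
Proof.
case: n => [|n]; first by rewrite /iterm /= ltr01 lexx.
suff h f u : incident u f -> 0 <= iterm n f u by rewrite bp_step_gt0 // bp_step_le1.
elim: n f u => [|n IHn] f u uf; first exact: ler01.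
exact/ltW/bp_step_gt0.
Qed.

(** [bp_step] is antitone and the iteration starts at the upper bound 1, so even iterates bound all
    later ones from above and odd iterates from below. *)
Let iterm_alternate n k e v :
  if odd n then iterm n e v <= iterm (n + k) e v else iterm (n + k) e v <= iterm n e v.
Proof.
elim: n e v => [|n IHn] e v /=; first by case/andP: (iterm_bounds k e v).
have [h1 h2] : (forall f u, 0 <= iterm n f u) /\ (forall f u, 0 <= iterm (n + k) f u).
  by split=> f u; apply/ltW;
    [case/andP: (iterm_bounds n f u)|case/andP: (iterm_bounds (n + k) f u)].
by case: (odd n) IHn => IHn; apply: bp_step_anti => f u _ //; apply: IHn.
Qed.

(** The first two iterates agree up to the factor [1 + z * D], and each step contracts the excess
    over 1 by [bp_rate]. *)
Let iterm_close n e v : iterm n e v <= (1 + bp_rate ^+ n * (z * D%:R)) * iterm n.+1 e v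
  /\ iterm n.+1 e v <= (1 + bp_rate ^+ n * (z * D%:R)) * iterm n e v.
Proof.
have it0 k f u : 0 <= iterm k f u by case/andP: (iterm_bounds k f u) => /ltW.
have it1 k f u : iterm k f u <= 1 by case/andP: (iterm_bounds k f u).
have s0 k f u : 0 <= \sum_(g | incident u g && (g != f)) iterm k g (other g u).
  by apply: sumr_ge0 => g _; apply: it0.
elim: n e v => [|n IHn] e v.
  rewrite expr0 mul1r mulr1; split.
    have hS := s0 0%N e v; have hD := sum_incident_leD e v (fun f u _ => it1 0%N f u).
    have h : z * \sum_(g | incident v g && (g != e)) iterm 0 g (other g v) <= z * D%:R.
      by rewrite ler_pM2l.
    rewrite [iterm 1 e v]/(bp_step (iterm 0) e v) /bp_step ler_pdivlMr.
      by rewrite mul1r lerD2l.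
    by rewrite ltr_pwDl // mulr_ge0 // ltW.
  apply: le_trans (it1 _ _ _) _; rewrite lerDl mulr_ge0 ?ler0n ?(ltW z_gt0) //.
have c0 : 0 <= bp_rate ^+ n * (z * D%:R).
  by rewrite mulr_ge0 ?exprn_ge0 ?bp_rate_ge0 // mulr_ge0 ?ler0n ?(ltW z_gt0).
have sD k f u := sum_incident_leD f u (fun g w _ => it1 k g w).
rewrite exprS -mulrA; split.
  apply: (bp_contract (s0 n e v) (sD n e v) (s0 n.+1 e v) c0).
  by rewrite mulr_sumr; apply: ler_sum => f _; case: (IHn f (other f v)).
apply: (bp_contract (s0 n.+1 e v) (sD n.+1 e v) (s0 n e v) c0).
by rewrite mulr_sumr; apply: ler_sum => f _; case: (IHn f (other f v)).
Qed.

(** With [m] the supremum of the odd iterates, both [m] and [bp_step m] lie between the iterates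
    [2N + 1] and [2N], whose gap decays geometrically. *)
Lemma bp_fixpoint_exists : exists m, bp_fixpoint m.
Proof.
pose E e v (x : R) := exists n, x = iterm (n.*2.+1) e v.
pose m e v := sup (E e v).
have lo n e v : iterm n.*2.+1 e v <= m e v.
  apply: sup_upper_bound; last by exists n.
  split; first by exists (iterm 1 e v), 0%N.
  by exists 1 => _ [k ->]; case/andP: (iterm_bounds k.*2.+1 e v).
have hi n e v : m e v <= iterm n.*2 e v.
  apply: sup_le_ub; first by exists (iterm 1 e v), 0%N.
  move=> _ [k ->]; have [kn|nk] := leqP k.*2.+1 n.*2.
    by have := iterm_alternate k.*2.+1 (n.*2 - k.*2.+1) e v; rewrite subnKC //= odd_double.
  by have := iterm_alternate n.*2 (k.*2.+1 - n.*2) e v; rewrite subnKC ?odd_double // ltnW.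
have m0 e v : 0 < m e v.
  by apply: lt_le_trans (lo 0%N e v); case/andP: (iterm_bounds 1 e v).
exists m => e v ve; split=> //.
have m0' f u : incident u f -> 0 <= m f u by move=> _; rewrite ltW.
have lo' n : iterm n.*2.+1 e v <= bp_step m e v by apply: bp_step_anti => // f u _.
have hi' n : bp_step m e v <= iterm n.+1.*2 e v.
  rewrite doubleS; apply: bp_step_anti => [f u _|f u _]; last exact: lo.
  by case/andP: (iterm_bounds n.*2.+1 f u) => /ltW.
have close n : iterm n.*2 e v - iterm n.*2.+1 e v <= z * D%:R * bp_rate ^+ n.*2.
  have [h _] := iterm_close n.*2 e v; have /andP[i0 i1] := iterm_bounds n.*2.+1 e v.
  have c0 : 0 <= bp_rate ^+ n.*2 * (z * D%:R).
    by rewrite mulr_ge0 ?exprn_ge0 ?bp_rate_ge0 // mulr_ge0 ?ler0n ?(ltW z_gt0).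
  have : bp_rate ^+ n.*2 * (z * D%:R) * iterm n.*2.+1 e v <= bp_rate ^+ n.*2 * (z * D%:R).
    by rewrite ler_piMr.
  lra.
apply/eqP; rewrite -subr_eq0 -normr_le0 leNgt; apply/negP => d0.
have [N hN] := geometric_lt (z * D%:R) bp_rate_ge0 bp_rate_lt1 d0.
have := hN N.*2; rewrite -addnn leq_addr addnn => /(_ isT).
have := close N; have := lo' N; have := hi' N; have := hi N e v; have := lo N e v.
have := iterm_alternate N.*2 2 e v; rewrite odd_double addn2 -doubleS.
move=> h1 h2 h3 h4 h5 h6 h7.
suff : `|m e v - bp_step m e v| <= iterm N.*2 e v - iterm N.*2.+1 e v by lra.
by rewrite ler_norml; apply/andP; split; lra.
Qed.

End BeliefPropagation.

(** * The Bethe value of a fixed point *)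

Section BetheValue.
Variables (G : mgraph) (R : realType) (z : R).
Hypothesis loopG : loopless G.
Hypothesis z_gt0 : 0 < z.
Implicit Types (m : gE G -> gV G -> R) (e : gE G) (v : gV G).

Definition bp_vertex m v : R := 1 + \sum_(f | incident v f) z * m f (other f v).

Definition bp_edge m e : R := z * m e (gends e).1 * m e (gends e).2.

Definition bp_marginal m e : R := bp_edge m e / (1 + bp_edge m e).

Definition bp_value m : R :=
  \sum_v ln (bp_vertex m v) - \sum_e ln (1 + bp_edge m e).

Variable m : gE G -> gV G -> R.
Hypothesis fix_m : bp_fixpoint z m.

Lemma bp_edgeE e v : incident v e -> bp_edge m e = z * m e v * m e (other e v).
Proof.
rewrite /bp_edge => /orP[] /eqP <-; first by rewrite other_l.
by rewrite other_r // mulrAC.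
Qed.

Lemma bp_message_gt0 e v : incident v e -> 0 < m e v.
Proof. by case/fix_m. Qed.

Lemma bp_edge_gt0 e : 0 < bp_edge m e.
Proof. by rewrite /bp_edge !mulr_gt0 // bp_message_gt0 ?incident_l ?incident_r. Qed.

Lemma bp_vertex_gt0 v : 0 < bp_vertex m v.
Proof.
rewrite ltr_pwDl // sumr_ge0 // => f vf.
by rewrite mulr_ge0 ?(ltW z_gt0) // ltW // bp_message_gt0 // incident_other.
Qed.

(** The fixed-point equation says that [(m e v)^-1] is the vertex sum without the term of [e]. The
    right-hand side is the same at both ends of [e], which makes the marginals consistent. *)
Lemma bp_vertex_message e v : incident v e -> m e v * bp_vertex m v = 1 + bp_edge m e.
Proof.
move=> ve; have [m0 mE] := fix_m ve.
have -> : bp_vertex m v = (m e v)^-1 + z * m e (other e v).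
  rewrite mE /bp_step invrK /bp_vertex -mulr_sumr (bigD1 e) //= mulrDr.
  by rewrite addrCA addrC.
by rewrite (bp_edgeE ve); field; rewrite gt_eqF.
Qed.

Lemma bp_marginalE e v : incident v e -> bp_marginal m e = z * m e (other e v) / bp_vertex m v.
Proof.
move=> ve; rewrite /bp_marginal -(bp_vertex_message ve) (bp_edgeE ve).
by field; rewrite !gt_eqF ?bp_vertex_gt0 ?bp_message_gt0.
Qed.

Lemma sum_bp_marginal v :
  \sum_(e | incident v e) bp_marginal m e = 1 - (bp_vertex m v)^-1.
Proof.
rewrite (eq_bigr _ (fun e ve => bp_marginalE ve)) -mulr_suml.
have -> : \sum_(e | incident v e) z * m e (other e v) = bp_vertex m v - 1.
  by rewrite /bp_vertex addrC addKr.
by rewrite mulrBl divff ?mul1r // gt_eqF // bp_vertex_gt0.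
Qed.

Lemma bp_marginal_fractional : fractional_matching (bp_marginal m).
Proof.
split=> [e|v].
  by rewrite divr_ge0 ?addr_ge0 ?(ltW (bp_edge_gt0 e)).
by rewrite sum_bp_marginal gerBl invr_ge0 ltW // bp_vertex_gt0.
Qed.

(** The slack at [v] is the inverse of [bp_vertex m v], so the vertex entropy is
    [ln (bp_vertex m v)] minus shares passed to the edges at [v]. On each edge [bp_vertex_message]
    rewrites these shares, and the messages cancel. *)
Lemma bethe_free_bp_marginal : bethe_free G z (bp_marginal m) = bp_value m.
Proof.
rewrite /bethe_free /bethe_entropy /bp_value.
have X0 e := bp_edge_gt0 e; have X1 e : 0 < 1 + bp_edge m e by rewrite addr_gt0.
have V0 v := bp_vertex_gt0 v.
have vertex v : - xlnx (1 - \sum_(e | incident v e) bp_marginal m e)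
   = ln (bp_vertex m v) - \sum_(e | incident v e) bp_marginal m e * ln (bp_vertex m v).
  rewrite -mulr_suml sum_bp_marginal subKr xlnxE lnV ?posrE //; ring.
have -> : - \sum_v xlnx (1 - \sum_(e | incident v e) bp_marginal m e)
   = \sum_v ln (bp_vertex m v) - \sum_e bp_marginal m e *
       (ln (bp_vertex m (gends e).1) + ln (bp_vertex m (gends e).2)).
  rewrite -sumrN (eq_bigr _ (fun v _ => vertex v)) sumrB (big_incident_ends loopG
    (fun e v => bp_marginal m e * ln (bp_vertex m v))).
  by congr (_ - _); apply: eq_bigr => e _; rewrite mulrDr.
rewrite mulr_suml addrA -big_split /= addrCA -sumrB; congr (_ + _).
rewrite -sumrN; apply: eq_bigr => e _.
have lnV' v : incident v e -> ln (bp_vertex m v) = ln (1 + bp_edge m e) - ln (m e v).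
  move=> ve; rewrite -(bp_vertex_message ve) lnM ?posrE ?bp_message_gt0 //.
  by rewrite addrC addKr.
rewrite !lnV' ?incident_l ?incident_r // !xlnxE.
have -> : ln (bp_marginal m e) = ln z + ln (m e (gends e).1) + ln (m e (gends e).2)
    - ln (1 + bp_edge m e).
  rewrite ln_div ?posrE // {1}/bp_edge !lnM ?posrE ?mulr_gt0 //;
  by rewrite ?bp_message_gt0 ?incident_l ?incident_r.
have -> : 1 - bp_marginal m e = (1 + bp_edge m e)^-1.
  by rewrite /bp_marginal; field; rewrite gt_eqF.
rewrite lnV ?posrE //.
have : (1 + bp_edge m e)^-1 = 1 - bp_marginal m e.
  by rewrite /bp_marginal; field; rewrite gt_eqF.
by move=> ->; ring.
Qed.

End BetheValue.

(** * Lifts of large girth *)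

Section Walks.
Variable G : mgraph.
Implicit Types (v : gV G) (e : gE G) (es : seq (gE G)).

(* A walk is given by its starting vertex and the sequence of its edges. *)
Fixpoint walk v es : bool :=
  if es is e :: es' then incident v e && walk (other e v) es' else true.

Definition walk_end v es : gV G := foldl (fun u e => other e u) v es.

(** Consecutive edges differ as edges, so two parallel edges count as a cycle of length 2. *)
Definition nonbacktracking es : bool := sorted (fun e f => e != f) es.

Definition no_short_cycle (r : nat) : Prop := forall v es,
  walk v es -> nonbacktracking es -> (0 < size es <= r)%N -> walk_end v es != v.

Lemma walk_cat v es es' : walk v (es ++ es') = walk v es && walk (walk_end v es) es'.
Proof. by elim: es v => //= e es IHes v; rewrite IHes andbA. Qed.

Lemma walk_end_cat v es es' : walk_end v (es ++ es') = walk_end (walk_end v es) es'.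
Proof. exact: foldl_cat. Qed.

Lemma nonbacktracking_catl es es' : nonbacktracking (es ++ es') -> nonbacktracking es.
Proof. by case: es => //= e es; rewrite /nonbacktracking /= cat_path => /andP[]. Qed.

Lemma nonbacktracking_catr es es' : nonbacktracking (es ++ es') -> nonbacktracking es'.
Proof.
case: es => //= e es; rewrite /nonbacktracking /= cat_path => /andP[_].
by apply: path_sorted.
Qed.

(** A second passage through [e] would close a nonbacktracking walk of length at most [r]: at [v] if
    [e] is entered from [v] again, at [other e v] if it is entered from there. *)
Lemma first_edge_simple r v e es : loopless G -> no_short_cycle r ->
  walk v (e :: es) -> nonbacktracking (e :: es) -> size es = r -> e \notin es.
Proof.
move=> loopG acyc wk nb sz; apply/negP => /splitPr E.
case: E wk nb sz => p1 p2; rewrite /= walk_cat /= => /and4P[ve w1 ue _] nb sz.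
have nb1 : nonbacktracking (e :: p1).
  by apply: (@nonbacktracking_catl _ (e :: p2)).
move: ue; rewrite (incidentE loopG _ ve) => /orP[]/eqP end1.
  have : walk_end v (e :: p1) != v.
    apply: acyc => //=; first by rewrite ve.
    by rewrite -sz size_cat /= addnS ltnS leq_addr.
  by rewrite /walk_end /= -/(walk_end _ _) end1 eqxx.
case: p1 w1 nb1 nb end1 sz => [|f p1] w1 nb1 nb end1 sz.
  by move: nb; rewrite /nonbacktracking /= eqxx.
have : walk_end (other e v) (f :: p1) != other e v.
  apply: acyc => //; first by case/andP: nb1.
  by move: sz; rewrite size_cat /=; lia.
by rewrite end1 eqxx.
Qed.

End Walks.

Section Lift.
Variables (G : mgraph) (s : gE G -> bool).
Hypothesis loopG : loopless G.
Let H := lift2 s.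
Implicit Types (u : gV H) (f : gE H).

Lemma lift2_loopless : loopless H.
Proof. by move=> [e b] /=; rewrite xpair_eqE negb_and loopG. Qed.

Lemma incident_lift2 u f : incident u f =
  (((gends f.1).1 == u.1) && (f.2 == u.2)) || (((gends f.1).2 == u.1) && (f.2 (+) s f.1 == u.2)).
Proof. by rewrite /incident /= -!pair_eqE. Qed.

Lemma incident_lift2_fst u f : incident u f -> incident u.1 f.1.
Proof.
by rewrite incident_lift2 /incident => /orP[]/andP[-> _]; rewrite ?orbT.
Qed.

Lemma other_lift2 u f : incident u f -> other f u = (other f.1 u.1, u.2 (+) s f.1).
Proof.
rewrite incident_lift2 => /orP[]/andP[/eqP h1 /eqP h2]; case: u h1 h2 => v b /= <- <-.
  by rewrite (other_l f : other f ((gends f.1).1, f.2) = _) other_l.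
rewrite (other_r lift2_loopless f : other f ((gends f.1).2, f.2 (+) s f.1) = _).
by rewrite other_r // -addbA addbb addbF.
Qed.

(** Local injectivity of the covering map; it keeps projected walks nonbacktracking. *)
Lemma lift2_edge_inj u f g : incident u f -> incident u g -> f.1 = g.1 -> f = g.
Proof.
case: f g => [e b] [e' b']; rewrite !incident_lift2 /= => + + ee; rewrite -ee.
move=> /orP[]/andP[/eqP h1 /eqP h2] /orP[]/andP[/eqP h3 /eqP h4]; congr (_, _).
- by rewrite h2 h4.
- by have := loopG e; rewrite h1 h3 eqxx.
- by have := loopG e; rewrite h1 h3 eqxx.
- by apply: (can_inj (addbK (s e))); rewrite h2 h4.
Qed.

(** The level flips whenever an edge with [s e = true] is crossed, so the end of a walk records the
    parity of these crossings. *)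
Lemma walk_lift2 u fs : walk u fs -> nonbacktracking fs ->
  [/\ walk u.1 (map fst fs), nonbacktracking (map fst fs) &
      walk_end u fs = (walk_end u.1 (map fst fs), u.2 (+) odd (count s (map fst fs)))].
Proof.
elim: fs u => [|f fs IHfs] u /=; first by rewrite addbF; case: u.
move=> /andP[uf wfs] nb; have [w1 nb1 e1] := IHfs _ wfs (path_sorted nb).
rewrite other_lift2 //= in w1 e1; rewrite (incident_lift2_fst uf) w1; split=> //.
  case: fs nb wfs nb1 {IHfs w1 e1} => [|g fs] //= /andP[fg nb] /andP[ug _] nb1.
  rewrite /nonbacktracking /= nb1 andbT; apply: contraNneq fg => fgE.
  have uf' : incident (other f u) f by apply: incident_other.
  by rewrite (lift2_edge_inj uf' ug fgE).
by rewrite /walk_end /= in e1 *; rewrite other_lift2 //= e1 oddD -addbA oddb.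
Qed.

Lemma no_short_cycle_lift2 r : no_short_cycle G r -> no_short_cycle H r.
Proof.
move=> acyc u fs wfs nb sz; have [w1 nb1 e1] := walk_lift2 wfs nb.
rewrite e1; have := acyc _ _ w1 nb1; rewrite size_map => /(_ sz).
by apply: contraNneq => E; rewrite -{2}E.
Qed.

End Lift.

Lemma lift2_bipartite (G : mgraph) (s : gE G -> bool) : bipartite G -> bipartite (lift2 s).
Proof. by case=> c hc; exists (fun u => c u.1) => -[e b] /=; apply: hc. Qed.

Fixpoint lift_chain (H : mgraph) (l : seq mgraph) : Prop :=
  if l is H' :: l' then is_2lift H H' /\ lift_chain H' l' else True.

Lemma lift_chain_rcons H l H' :
  lift_chain H l -> is_2lift (last H l) H' -> lift_chain H (rcons l H').
Proof. by elim: l H => [|K l IHl] H //= [HK Kl] lH'; split=> //; apply: IHl. Qed.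

Lemma is_2lift_bipartite H H' : is_2lift H H' -> bipartite H -> bipartite H'.
Proof. by case=> s ->; apply: lift2_bipartite. Qed.

Lemma lift_chain_bipartite H l : lift_chain H l -> bipartite H -> bipartite (last H l).
Proof. by elim: l H => [|K l IHl] H //= [/is_2lift_bipartite HK /IHl]; auto. Qed.

(* After successively lifting along the indicator of every edge in [L], a closed walk
   projects to a closed walk using each edge in [L] an even number of times. *)
Lemma even_cover (G : mgraph) (L : seq (gE G)) : bipartite G ->
  exists l (piV : gV (last G l) -> gV G) (piE : gE (last G l) -> gE G),
  [/\ l <> [::], lift_chain G l &
      forall u fs, walk u fs -> nonbacktracking fs -> walk_end u fs = u ->
      let es := map piE fs in
      [/\ walk (piV u) es, nonbacktracking es, walk_end (piV u) es = piV u
        & forall e, e \in L -> ~~ odd (count_mem e es)]].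
Proof.
move=> bipG; elim: L => [|e L [l [piV [piE [l0 chl hl]]]]].
  (* The trivial lift, two disjoint copies, makes the chain nonempty, so that the tower always has a
     next lift. *)
  exists [:: lift2 (fun _ : gE G => false)], fst, fst; split=> //=.
    by split=> //; exists (fun=> false).
  move=> u fs wfs nb cl; have [w1 nb1 e1] := walk_lift2 (bipartite_loopless bipG) wfs nb.
  by split=> //; move: cl; rewrite e1 => {2}<-.
have bipL := lift_chain_bipartite chl bipG.
(* The new lift switches exactly the edges above [e], so a walk closed in it crosses them an even
   number of times. *)
pose s f := piE f == e.
have lastE : last G (rcons l (lift2 s)) = lift2 s by rewrite last_rcons.
exists (rcons l (lift2 s)); rewrite lastE.
exists (piV \o fst), (piE \o fst); split.
- by move=> /(congr1 size); rewrite size_rcons.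
- by apply: lift_chain_rcons => //; exists s.
- move=> u fs wfs nb cl; have [w1 nb1 e1] := walk_lift2 (bipartite_loopless bipL) wfs nb.
  have [cl1 cl2] : walk_end u.1 (map fst fs) = u.1 /\ u.2 (+) odd (count s (map fst fs)) = u.2.
    by move: cl; rewrite e1; case: u {wfs w1 e1} => a b /= [-> ->].
  have [w2 nb2 e2 ev] := hl _ _ w1 nb1 cl1; rewrite -map_comp in w2 nb2 e2 ev.
  split=> // f; rewrite inE => /orP[/eqP->|]; last exact: ev.
  move: cl2; rewrite !count_map /=; case: (u.2) => /=; case: (odd _) => //.
Qed.

(** A closed walk of length [r.+1] would project to one whose first edge occurs exactly once,
    against the evenness from [even_cover]; shorter ones are excluded in [G]. *)
Lemma girth_step (G : mgraph) r : bipartite G -> no_short_cycle G r ->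
  exists l, [/\ l <> [::], lift_chain G l & no_short_cycle (last G l) r.+1].
Proof.
move=> bipG acyc; have [l [piV [piE [l0 chl hl]]]] := even_cover (enum (gE G)) bipG.
exists l; split=> // u fs wfs nb /andP[sz0 sz]; apply/eqP => cl.
have [w1 nb1 e1 ev] := hl u fs wfs nb cl.
have sz1 : size (map piE fs) = size fs by rewrite size_map.
have [szr|szr] := leqP (size fs) r.
  by have := acyc _ _ w1 nb1; rewrite sz1 sz0 szr e1 eqxx => /(_ isT).
have szE : size (map piE fs) = r.+1 by rewrite sz1; lia.
case: (map piE fs) w1 nb1 e1 ev szE => // e es w1 nb1 e1 ev [szE].
have := first_edge_simple (bipartite_loopless bipG) acyc w1 nb1 szE.
have := ev e; rewrite mem_enum /= eqxx => /(_ isT) + ne.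
by rewrite (count_memPn ne).
Qed.

Lemma large_girth_lifts (G : mgraph) : bipartite G ->
  exists Gs : nat -> mgraph,
    [/\ Gs 0%N = G, forall n, bipartite (Gs n), forall n, is_2lift (Gs n) (Gs n.+1)
      & forall r, exists N, forall n, (N <= n)%N -> no_short_cycle (Gs n) r].
Proof.
move=> bipG.
have /choice[plan planP] : forall Hr : mgraph * nat, exists Hl : mgraph * seq mgraph,
    bipartite Hr.1 -> no_short_cycle Hr.1 Hr.2 ->
    [/\ is_2lift Hr.1 Hl.1, lift_chain Hl.1 Hl.2 & no_short_cycle (last Hl.1 Hl.2) Hr.2.+1].
  move=> [H r].
  have [[bipH acyc]|nH] := pselect (bipartite H /\ no_short_cycle H r); last first.
    by exists (H, [::]) => bH aH; case: nH.
  have [[|H' l] [l0 chl acl]] := girth_step bipH acyc; first by case: l0.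
  by exists (H', l) => _ _; case: chl.
(* A state holds the current graph, the lifts still to be performed, and the girth bound valid after
   them; an empty list calls for the next chain. *)
pose next (st : mgraph * seq mgraph * nat) :=
  let: (H, l, r) := st in
  if l is H' :: l' then (H', l', r) else let: (H', l') := plan (H, r) in (H', l', r.+1).
pose st n := iter n next (G, [::], 0%N).
pose Inv (t : mgraph * seq mgraph * nat) :=
  [/\ bipartite t.1.1, lift_chain t.1.1 t.1.2 & no_short_cycle (last t.1.1 t.1.2) t.2].
have step t : Inv t -> Inv (next t) /\ is_2lift t.1.1 (next t).1.1.
  case: t => [[H [|H' l]] r] /= [/= bipH chl acl]; last first.
    by case: chl => HH' chl; split=> //; split=> //=; apply: is_2lift_bipartite bipH.
  have := planP (H, r) bipH acl; case: (plan (H, r)) => H' l /= [HH2 chl2 acl2].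
  by split=> //; split=> //=; apply: is_2lift_bipartite bipH.
have inv n : Inv (st n).
  by elim: n => [|n /step[]//]; split=> //= v es _ _; case: es.
have lift n : is_2lift (st n).1.1 (st n.+1).1.1 by case: (step _ (inv n)).
exists (fun n => (st n).1.1); split=> // [n|r]; first by case: (inv n).
have drain n H l r' : st n = (H, l, r') -> exists n' H', st n' = (H', [::], r').
  elim: l n H => [|H' l IHl] n H stE; first by exists n, H.
  by apply: (IHl n.+1 H'); rewrite /st iterS -/(st n) stE.
have reach k : exists n H, st n = (H, [::], k).
  elim: k => [|k [n [H stE]]]; first by exists 0%N, G.
  have : st n.+1 = next (H, [::], k) by rewrite /st iterS -/(st n) stE.
  case E : (next _) => [[H' l] k'] /drain; move: E; rewrite /=.
  by case: (plan (H, k)) => ? ? [_ _ <-].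
have [N [H stE]] := reach r; exists N => n Nn.
rewrite -(subnKC Nn); elim: (n - N)%N => [|d IHd].
  by rewrite addn0; have [_ _] := inv N; rewrite stE.
rewrite addnS; case: (lift (N + d)%N) => s ->.
apply: no_short_cycle_lift2 => //; apply: bipartite_loopless.
by case: (inv (N + d)%N).
Qed.

(** * Decay of correlations *)

Section CorrelationDecay.
Variables (G : mgraph) (R : realType) (z : R) (D r : nat).
Hypothesis loopG : loopless G.
Hypothesis z_gt0 : 0 < z.
Hypothesis degD : degree_le G D.
Hypothesis acyc : no_short_cycle G r.
Variable m : gE G -> gV G -> R.
Hypothesis fix_m : bp_fixpoint z m.

(** The half-edge of [f] at [v] stands for the missing far end, through the message which that end
    sends. *)
Definition incoming (f : gE G) (v : gV G) : R := z * m f (other f v).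

Let z_ge0 : 0 <= z := ltW z_gt0.

Let m_gt0 f v : incident v f -> 0 < m f v.
Proof. by case/fix_m. Qed.

Let m_le1 f v : incident v f -> m f v <= 1.
Proof. by move=> vf; have [_ ->] := fix_m vf; apply: bp_step_le1 => // g u /m_gt0/ltW. Qed.

Let incoming_ge0 f v : incident v f -> 0 <= incoming f v.
Proof. by move=> vf; rewrite mulr_ge0 // ltW // m_gt0 // incident_other. Qed.

Section EdgeRemoved.
Variables (e : gE G) (S : {set gE G}).
Hypothesis eS : e \notin S.

Let Z (W : {set gV G}) : R := delZ e S (fun=> z) incoming W.

Let Z_gt0 W : 0 < Z W.
Proof. by apply: delZ_gt0 => // f v; apply: incoming_ge0. Qed.

Let ratio W c : R := Z (W :\ c) / Z W.

Let ratio_gt0 W c : 0 < ratio W c.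
Proof. by rewrite divr_gt0. Qed.

(** The recurrence in the shape of [bp_step]: cut edges feed in messages, joined edges feed in
    ratios of the smaller set. This allows ratios and messages to be compared step by step. *)
Let ratioV (W : {set gV G}) c : c \in W -> (ratio W c)^-1 = 1 + z *
  (\sum_(f | incident c f && (f \notin e |: S)) m f (other f c)
   + \sum_(f | [&& incident c f, other f c \in W & f \in S]) ratio (W :\ c) (other f c)).
Proof.
move=> cW; rewrite /ratio invf_div {1}/Z /delZ (mdZ_rec loopG _ _ cW) -/(delZ e S _ _ _).
rewrite mulrDl mulfK ?gt_eqF // /halfedge_monomer -addrA mulrDr !mulr_sumr; congr (_ + (_ + _)).
rewrite mulr_suml [LHS]big_mkcond [RHS]big_mkcond /=; apply: eq_bigr => f _.
rewrite andbA; case: (incident c f && _) => //=; rewrite /joined_weight.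
by case: (f \in S); rewrite ?mul0r // mulrA.
Qed.

Let ratio_le1 (W : {set gV G}) c : c \in W -> ratio W c <= 1.
Proof.
move=> cW; rewrite -[ratio W c]invrK ratioV // invf_le1; last first.
  rewrite ltr_pwDl // mulr_ge0 // addr_ge0 //; apply: sumr_ge0 => f.
    by case/andP=> cf _; rewrite ltW // m_gt0 // incident_other.
  by move=> _; apply: ltW.
rewrite lerDl mulr_ge0 // addr_ge0 //; apply: sumr_ge0 => f.
  by case/andP=> cf _; rewrite ltW // m_gt0 // incident_other.
by move=> _; apply: ltW.
Qed.

Let ratio_ge (W : {set gV G}) c : c \in W -> 1 <= (1 + z * D%:R) * ratio W c.
Proof.
move=> cW; rewrite -ler_pdivrMr // mul1r ratioV // lerD2l ler_pM2l //.
apply: le_trans (_ : \sum_(f in [set f | incident c f]) 1 <= _); last first.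
  by rewrite sumr_const ler_nat degD.
rewrite big_mkcond /= [X in _ + X]big_mkcond /= -big_split /= [leRHS]big_mkcond.
apply: ler_sum => f _; rewrite !inE negb_or.
have [cf|] := boolP (incident c f); last by rewrite addr0.
have m1 : m f (other f c) <= 1 by rewrite m_le1 // incident_other.
case: (f \in S); rewrite ?andbF ?andbT /= ?add0r ?addr0.
  case: ifP => // oW; apply: ratio_le1; rewrite !inE oW andbT; exact: other_neq.
by case: ifP.
Qed.

(* [p] is the path already explored from [v0]; its vertices, except the last one [c] and
   possibly [v0], have been removed from [W]. *)
Let decay k v0 p g c (W : {set gV G}) :
  walk v0 (rcons p g) -> nonbacktracking (rcons p g) -> ((size p).+1 + k <= r)%N ->
  head g p = e -> walk_end v0 (rcons p g) = c -> c \in W -> g \in e |: S ->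
  (g \in S -> other g c \notin W) ->
  (forall u, (forall p1 p2, rcons p g = p1 ++ p2 -> walk_end v0 p1 != u) -> u \in W) ->
  ratio W c <= (1 + bp_rate z D ^+ k * (z * D%:R)) * m g c
  /\ m g c <= (1 + bp_rate z D ^+ k * (z * D%:R)) * ratio W c.
Proof.
elim: k p g c W => [|k IHk] p g c W wp nb sz hd endp cW gS gW hW.
all: have cg : incident c g
  by rewrite -endp -cats1 walk_end_cat /=; move: wp; rewrite -cats1 walk_cat /= => /and3P[_ vg _];
     apply: incident_other.
  (* With no steps left, both quantities lie between [(1 + z * D)^-1] and 1. *)
  rewrite expr0 mul1r; have d0 : 1 <= 1 + z * D%:R by rewrite lerDl mulr_ge0.
  split; first apply: le_trans (ratio_le1 cW) _.
    have [_ ->] := fix_m cg; rewrite /bp_step ler_pdivlMr ?mul1r.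
      rewrite lerD2l ler_pM2l //; apply: sum_incident_leD => // f u uf; exact: m_le1.
    rewrite ltr_pwDl // mulr_ge0 // sumr_ge0 // => f /andP[cf _].
    by rewrite ltW // m_gt0 // incident_other.
  exact: le_trans (m_le1 cg) (ratio_ge cW).
(* The girth enters here: returning to a visited vertex would close a nonbacktracking walk of length
   at most [r]. *)
have unvisited f : incident c f -> f != g ->
    forall p1 p2, rcons p g = p1 ++ p2 -> walk_end v0 p1 != other f c.
  move=> cf fg p1 p2 pE; apply/eqP => cl.
  have e2 : walk_end (other f c) p2 = c by rewrite -cl -walk_end_cat -pE.
  have : walk_end (other f c) (rcons p2 f) != other f c.
    have w2 : walk (other f c) p2 by move: wp; rewrite pE walk_cat cl => /andP[].
    have nb2 : nonbacktracking p2 by move: nb; rewrite pE => /nonbacktracking_catr.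
    apply: acyc.
    - by rewrite -cats1 walk_cat w2 e2 /= cf.
    - case/lastP: p2 pE nb2 {e2 w2 cl} => // p2 h; rewrite -rcons_cat => /rcons_inj[_ <-] nb2.
      case: p2 nb2 => [|h' p2]; rewrite /nonbacktracking /= ?rcons_path ?last_rcons /=.
        by rewrite eq_sym fg.
      by move=> ->; rewrite eq_sym fg.
    - rewrite size_rcons /=; apply: leq_trans sz; rewrite addnS ltnS.
      by apply: leq_trans (leq_addr _ _); rewrite -(size_rcons p g) pE size_cat leq_addl.
  by rewrite -cats1 walk_end_cat e2 /= eqxx.
have oW f : incident c f -> f != g -> other f c \in W :\ c.
  move=> cf fg; rewrite !inE (other_neq loopG cf) /=; apply: hW; exact: unvisited.
have ne f : incident c f -> f != g -> f != e.
  move=> cf fg; apply/eqP => fe; move: wp unvisited; rewrite fe in cf fg *.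
  have [h [q qE]] : exists h q, rcons p g = h :: q /\ h = e.
    by case: (p) hd => [|h q] /= <-; [exists g, [::]|exists h, (rcons q g)].
  move: qE => [qE hE]; rewrite qE hE /= => /andP[v0e _] /(_ e cf fg) un.
  have := un [::] (e :: q) erefl; have := un [:: e] q erefl; rewrite /=.
  have := incident_other e c; rewrite (incidentE loopG _ v0e) => /orP[]/eqP->; rewrite ?eqxx //.
pose t f := if f \in S then ratio (W :\ c) (other f c) else m f (other f c).
(* [g] does not contribute: if it is joined, its other end has left [W]; otherwise it is [e], which
   is absent. *)
have ratioE : ratio W c = (1 + z * \sum_(f | incident c f && (f != g)) t f)^-1.
  rewrite -[LHS]invrK ratioV //; congr (_ ^-1); congr (1 + z * _).
  rewrite big_mkcond /= [X in _ + X]big_mkcond /= -big_split /= [RHS]big_mkcond.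
  apply: eq_bigr => f _; rewrite !inE negb_or /t.
  have [cf|] := boolP (incident c f); last by rewrite addr0.
  have [fg|fg] := eqVneq f g.
    rewrite fg; move: gS gW; rewrite !inE; case: (g \in S) => /= [_ /(_ isT)/negPf->|].
      by rewrite andbF addr0.
    by rewrite orbF => -> _; rewrite andbF addr0.
  have := oW f cf fg; rewrite !inE => /andP[_ ->]; rewrite (ne f cf fg) /=.
  by case: (f \in S) => /=; rewrite ?add0r ?addr0.
have close f : incident c f && (f != g) ->
    t f <= (1 + bp_rate z D ^+ k * (z * D%:R)) * m f (other f c)
    /\ m f (other f c) <= (1 + bp_rate z D ^+ k * (z * D%:R)) * t f.
  case/andP=> cf fg; rewrite /t.
  have e0 : 0 <= bp_rate z D ^+ k * (z * D%:R).
    by rewrite mulr_ge0 ?exprn_ge0 ?bp_rate_ge0 // mulr_ge0.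
  have m0 : 0 <= m f (other f c) by rewrite ltW // m_gt0 // incident_other.
  case: ifP => fS; last by split; rewrite ler_peMl // lerDl.
  apply: (IHk (rcons p g) f) => //.
  - by rewrite -cats1 walk_cat wp endp /= cf.
  - move: nb; rewrite /nonbacktracking; case: (p) => [|h q] /=; first by rewrite eq_sym fg.
    by move=> nb0; rewrite rcons_path last_rcons nb0 eq_sym fg.
  - by rewrite size_rcons addSnnS.
  - by move: hd; case: (p).
  - by rewrite -cats1 walk_end_cat endp.
  - exact: oW.
  - by rewrite inE fS orbT.
  - by move=> _; rewrite (otherK loopG cf) !inE eqxx.
  - move=> u hu; rewrite !inE; apply/andP; split.
      by have := hu (rcons p g) [:: f]; rewrite cats1 endp eq_sym => /(_ erefl).
    by apply: hW => p1 p2 pE; apply: (hu p1 (rcons p2 f)); rewrite -rcons_cat -pE.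
have t0 f : incident c f && (f != g) -> 0 <= t f.
  by case/andP=> cf fg; rewrite /t; case: ifP => _; rewrite ltW // m_gt0 // incident_other.
have t1 f : incident c f && (f != g) -> t f <= 1.
  case/andP=> cf fg; rewrite /t; case: ifP => _; first by rewrite ratio_le1 ?oW.
  by rewrite m_le1 // incident_other.
have s0 : 0 <= \sum_(f | incident c f && (f != g)) t f by apply: sumr_ge0.
have sm0 : 0 <= \sum_(f | incident c f && (f != g)) m f (other f c).
  by apply: sumr_ge0 => f /andP[cf _]; rewrite ltW // m_gt0 // incident_other.
have smD : \sum_(f | incident c f && (f != g)) m f (other f c) <= D%:R.
  by apply: sum_incident_leD => // f u; apply: m_le1.
have sD : \sum_(f | incident c f && (f != g)) t f <= D%:R.
  apply: le_trans (_ : \sum_(f in [set f | incident c f]) 1 <= _); last first.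
    by rewrite sumr_const ler_nat degD.
  rewrite big_mkcond [leRHS]big_mkcond; apply: ler_sum => f _; rewrite inE.
  case: ifP => [cfg|_]; last by case: ifP.
  by case/andP: (cfg) => -> _; apply: t1.
have c0 : 0 <= bp_rate z D ^+ k * (z * D%:R).
  by rewrite mulr_ge0 ?exprn_ge0 ?bp_rate_ge0 // mulr_ge0.
have [_ mE] := fix_m cg; rewrite ratioE mE /bp_step exprS -mulrA.
split; apply: bp_contract => //; rewrite mulr_sumr; apply: ler_sum => f /close[] //.
Qed.

Lemma cutZ_join_le k : (k < r)%N ->
  cutZ (e |: S) (fun=> z) incoming setT * (1 + bp_edge z m e)
  <= cutZ S (fun=> z) incoming setT * (1 + 2 * z * (bp_rate z D ^+ k * (z * D%:R))).
Proof.
move=> kr; set eps := bp_rate z D ^+ k * (z * D%:R).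
have eps0 : 0 <= eps by rewrite mulr_ge0 ?exprn_ge0 ?bp_rate_ge0 // mulr_ge0.
set a := (gends e).1; set b := (gends e).2; have ab : a != b := loopG e.
have ae : incident a e := incident_l e; have be : incident b e := incident_r e.
have oa : other e a = b by rewrite other_l.
have ob : other e b = a by rewrite other_r.
(* Decay along the one-edge path from [b] to [a], used once with [b] present and once with [b]
   deleted. *)
have dec (W : {set gV G}) : a \in W -> (forall u, u != b -> u \in W) ->
    ratio W a <= (1 + eps) * m e a /\ m e a <= (1 + eps) * ratio W a.
  move=> aW hW; apply: (@decay k b [::] e) => //=.
  - by rewrite be.
  - by rewrite setU11.
  - by rewrite (negPf eS).
  - by move=> u hu; apply: hW; have := hu [::] [:: e] erefl; rewrite eq_sym.
have [_ hT] := dec setT (in_setT _) (fun u _ => in_setT u).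
have bW u : u != b -> u \in setT :\ b by rewrite !inE andbT.
have [hb _] := dec (setT :\ b) (bW a ab) bW.
have gam := @ratio_le1 setT b (in_setT _); have bet := @ratio_le1 setT a (in_setT _).
rewrite (cutZ_cut loopG _ _ eS) (cutZ_join loopG _ _ eS) -!/(Z _) -/a -/b.
have <- : setT :\ b :\ a = setT :\ a :\ b by apply/setP => v; rewrite !inE andbCA.
have -> : bp_edge z m e = z * m e a * m e b by [].
rewrite /incoming oa ob.
have m0 := m_gt0 ae; have m0' := m_gt0 be; have m1 := m_le1 ae; have m1' := m_le1 be.
have A0 := Z_gt0 setT; have B0 := Z_gt0 (setT :\ a); have C0 := Z_gt0 (setT :\ b).
have D0 := Z_gt0 (setT :\ b :\ a).
move: hT hb gam bet; rewrite /ratio !ler_pdivrMr // mul1r mulrA ler_pdivlMr //.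
move: (m e a) (m e b) (Z setT) (Z (setT :\ a)) (Z (setT :\ b)) (Z (setT :\ b :\ a))
  m0 m0' m1 m1' A0 B0 C0 D0 => x y A B C T.
move=> x0 y0 x1 y1 A0 B0 C0 T0 hT hb gam bet.
(* The joined side, times [1 + z * x * y], exceeds the cut side by
   [z * (T - x * C) + z * y * (x * A - B)]. Both brackets would vanish if the ratios [T / C] and
   [B / A] were equal to the message [x]. *)
have k1 : T - x * C <= eps * A.
  have : eps * (x * C) <= eps * A by
    rewrite ler_wpM2l //; apply: le_trans gam; rewrite ler_piMl // ltW.
  lra.
have k2 : y * (x * A - B) <= eps * A.
  have h : x * A - B <= eps * A.
    have : eps * B <= eps * A by rewrite ler_wpM2l.
    lra.
  have [p|p] := lerP 0 (x * A - B).
    by apply: le_trans h; rewrite ler_piMl.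
  apply: le_trans (_ : 0 <= _); last by rewrite mulr_ge0 // ltW.
  by rewrite nmulr_lle0 // ltW.
have : z * (T - x * C + y * (x * A - B)) <= z * (eps * A + eps * A) by rewrite ler_pM2l // lerD.
have e2 : 0 <= z * eps by rewrite mulr_ge0.
have : 0 <= (2 * (z * eps)) * (z * y * B + z * x * C + z * y * (z * x) * T).
  move: (ltW x0) (ltW y0) (ltW B0) (ltW C0) (ltW T0) => x0' y0' B0' C0' T0'.
  by apply: mulr_ge0; [rewrite mulr_ge0|do !apply: addr_ge0; do !apply: mulr_ge0].
lra.
Qed.

End EdgeRemoved.

(** With all edges cut the partition function is the product of the [bp_vertex]. Joining the edges
    one at a time divides by [1 + bp_edge] each time, up to a factor [1 + eps]. *)
Lemma ln_matching_poly_le k : (k < r)%N ->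
  ln (matching_poly G z) <=
  bp_value z m + #|gE G|%:R * (2 * z * (bp_rate z D ^+ k * (z * D%:R))).
Proof.
move=> kr; set eps := 2 * z * _.
have eps0 : 0 <= eps.
  apply: mulr_ge0; first by rewrite mulr_ge0.
  by rewrite mulr_ge0 ?exprn_ge0 ?bp_rate_ge0 // mulr_ge0.
have X0 e := bp_edge_gt0 z_gt0 fix_m e.
have F0 S : 0 < cutZ S (fun=> z) incoming setT by apply: cutZ_gt0 => // f v; apply: incoming_ge0.
have gen (S : {set gE G}) : ln (cutZ S (fun=> z) incoming setT) <=
    \sum_v ln (bp_vertex z m v) - \sum_(e in S) ln (1 + bp_edge z m e) + #|S|%:R * eps.
  have [n] := ubnP #|S|; elim: n S => // n IHn S cS.
  have [->|[e eS]] := set_0Vmem S.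
    rewrite cutZ_set0 // big_set0 cards0 mul0r addr0 subr0 ln_prod // => v.
    exact: bp_vertex_gt0.
  pose S' := S :\ e; have eS' : e \notin S' by rewrite !inE eqxx.
  have SE : S = e |: S' by rewrite setD1K.
  have cS' : (#|S'| < n)%N by rewrite -ltnS (leq_ltn_trans _ cS) // [leqRHS](cardsD1 e) eS.
  have e1 : 0 < 1 + eps by rewrite ltr_pwDl.
  have X1 : 0 < 1 + bp_edge z m e by rewrite addr_gt0.
  have h : ln (cutZ S (fun=> z) incoming setT) + ln (1 + bp_edge z m e)
      <= ln (cutZ S' (fun=> z) incoming setT) + ln (1 + eps).
    rewrite -!lnM ?posrE // ler_ln ?posrE ?mulr_gt0 // SE.
    exact: (cutZ_join_le eS' kr).
  have := IHn _ cS'; have : ln (1 + eps) <= eps by apply: le_ln1Dx; lra.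
  have -> : #|S| = (1 + #|S'|)%N by rewrite (cardsD1 e S) eS.
  by rewrite (big_setD1 e eS) /= -/S' natrD mulrDl mul1r; lra.
have := gen setT; rewrite cardsT /bp_value.
rewrite [X in _ - X](eq_bigl xpredT) => [|e]; last by rewrite inE.
apply: le_trans; rewrite matching_polyE /cutZ le_eqVlt; apply/orP; left; apply/eqP; congr ln.
apply: eq_mdZ => [e _ _|v _]; first by rewrite /joined_weight inE.
by rewrite /halfedge_monomer big1 ?addr0 // => e; rewrite inE andbF.
Qed.

End CorrelationDecay.

(** * Passing to the limit along the tower of lifts *)

Section LiftTransfer.
Variables (G : mgraph) (s : gE G -> bool).
Hypothesis loopG : loopless G.
Let H := lift2 s.

Lemma big_incident_lift2 (K : nmodType) (F : gE G -> K) (u : gV H) :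
  \sum_(f : gE H | incident u f) F f.1 = \sum_(e | incident u.1 e) F e.
Proof.
(* [h e] is the lift of [e] at [u]; the covering map is a bijection between the edges at [u] and
   those at [u.1]. *)
pose h e : gE H := (e, if (gends e).1 == u.1 then u.2 else u.2 (+) s e).
have uh e : incident u.1 e -> incident u (h e).
  rewrite incident_lift2 /h /= /incident; have [_|_] /= := eqVneq (gends e).1 u.1.
    by rewrite eqxx.
  by move=> ->; rewrite -addbA addbb addbF eqxx.
rewrite (reindex_onto h fst) => [|f uf]; last first.
  by apply: (lift2_edge_inj loopG (u := u)) => //; apply/uh/incident_lift2_fst.
apply: eq_bigl => e; rewrite eqxx andbT; apply/idP/idP => [/incident_lift2_fst //|].
exact: uh.
Qed.

Lemma big_lift2 (K : nmodType) (T : finType) (F : T -> K) :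
  \sum_(u : T * bool) F u.1 = (\sum_v F v) *+ 2.
Proof.
rewrite -(pair_big xpredT xpredT (fun v _ => F v)) /= -sumrMnl.
by apply: eq_bigr => v _; rewrite sumr_const card_bool.
Qed.

Lemma degree_le_lift2 D : degree_le G D -> degree_le H D.
Proof.
move=> degD u; rewrite -sum1_card (eq_bigl (incident u)) => [|f]; last by rewrite inE.
rewrite (big_incident_lift2 (fun=> 1%N)); apply: leq_trans (degD u.1).
by rewrite -sum1_card [leqRHS](eq_bigl (incident u.1)) // => e; rewrite inE.
Qed.

Variable R : realType.

Lemma bp_fixpoint_lift2 (z : R) m :
  bp_fixpoint z m -> bp_fixpoint z (fun (f : gE H) u => m f.1 u.1).
Proof.
move=> fix_m f u uf; have [m0 mE] := fix_m _ _ (incident_lift2_fst uf); split=> //.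
rewrite mE /bp_step; congr (1 + z * _)^-1.
pose F g := if g != f.1 then m g (other g u.1) else 0.
rewrite [LHS]big_mkcondr /= -(big_incident_lift2 F) [RHS]big_mkcondr /=.
apply: eq_bigr => g ug; rewrite /F (other_lift2 loopG ug) /=.
have [gf|gf] := eqVneq g f; first by rewrite gf eqxx.
by case: eqP => // /(lift2_edge_inj loopG ug uf)/eqP; rewrite (negPf gf).
Qed.

Lemma bp_value_lift2 (z : R) (m : gE G -> gV G -> R) :
  bp_value z (fun (f : gE H) u => m f.1 u.1) = 2 * bp_value z m.
Proof.
rewrite /bp_value mulrBr !mulr_natl -!big_lift2; congr (_ - _); apply: eq_bigr => u _.
congr (ln (1 + _)); rewrite -big_incident_lift2; apply: eq_bigr => f uf.
by rewrite (other_lift2 loopG uf).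
Qed.

Lemma fractional_matching_lift2 (x : gE G -> R) :
  fractional_matching x -> fractional_matching (fun f : gE H => x f.1).
Proof. by move=> [x0 x1]; split=> [f|u] //; rewrite big_incident_lift2. Qed.

Lemma bethe_free_lift2 (z : R) (x : gE G -> R) :
  bethe_free H z (fun f => x f.1) = 2 * bethe_free G z x.
Proof.
rewrite /bethe_free /bethe_entropy mulrDr mulrBr mulrA !mulr_natl -!big_lift2.
congr (_ + (_ - _)); apply: eq_bigr => u _; by rewrite big_incident_lift2.
Qed.

End LiftTransfer.

From mathcomp Require Import all_classical all_reals all_analysis.
Local Open Scope classical_set_scope.
Local Open Scope ring_scope.

Section LiftTower.
Variables (R : realType) (Gs : nat -> mgraph).
Hypothesis bipGs : forall n, bipartite (Gs n).
Hypothesis liftGs : forall n, is_2lift (Gs n) (Gs n.+1).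
Variables (z : R) (z_gt0 : 0 < z).

Let loopGs n : loopless (Gs n) := bipartite_loopless (bipGs n).

Lemma tower_card n : nverts (Gs n) = (2 ^ n * nverts (Gs 0))%N
  /\ #|gE (Gs n)| = (2 ^ n * #|gE (Gs 0)|)%N.
Proof.
elim: n => [|n [IHv IHe]]; first by rewrite !mul1n.
case: (liftGs n) => s ->.
by rewrite {1}/nverts !card_prod card_bool -/(nverts _) IHv IHe expnS; split; lia.
Qed.

Lemma tower_degree D n : degree_le (Gs 0) D -> degree_le (Gs n) D.
Proof.
by move=> degD; elim: n => // n IHn; case: (liftGs n) => s ->; apply: degree_le_lift2.
Qed.

Lemma tower_bp_value m n : bp_fixpoint z m ->
  exists2 mn : gE (Gs n) -> gV (Gs n) -> R, bp_fixpoint z mn &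
    bp_value z mn = 2 ^+ n * @bp_value (Gs 0) R z m.
Proof.
move=> fix_m; elim: n => [|n [mn fix_mn mnE]]; first by exists m; rewrite ?mul1r.
case: (liftGs n) => s ->; exists (fun (f : gE (lift2 s)) u => mn f.1 u.1).
  exact: bp_fixpoint_lift2.
by rewrite bp_value_lift2 // mnE exprS mulrA.
Qed.

Lemma tower_fractional x n : fractional_matching x ->
  exists2 xn : gE (Gs n) -> R, fractional_matching xn &
    bethe_free (Gs n) z xn = 2 ^+ n * bethe_free (Gs 0) z x.
Proof.
move=> fx; elim: n => [|n [xn fxn xnE]]; first by exists x; rewrite ?mul1r.
case: (liftGs n) => s ->; exists (fun f : gE (lift2 s) => xn f.1).
  exact: fractional_matching_lift2.
by rewrite bethe_free_lift2 // xnE exprS mulrA.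
Qed.

Hypothesis girthGs : forall r, exists N, forall n, (N <= n)%N -> no_short_cycle (Gs n) r.

Lemma tower_limit : exists2 xs : gE (Gs 0) -> R, fractional_matching xs &
  (forall x, fractional_matching x -> bethe_free (Gs 0) z x <= bethe_free (Gs 0) z xs) /\
  ((fun n => (nverts (Gs n))%:R^-1 * ln (matching_poly (Gs n) z))
     @ \oo --> ((nverts (Gs 0))%:R^-1 * bethe_free (Gs 0) z xs : R)).
Proof.
(* The number of edges is a crude degree bound that all lifts inherit; it reappears in [err] as the
   edge count of the lift divided by [2 ^ n]. *)
pose D := #|gE (Gs 0)|.
have degD : degree_le (Gs 0) D by move=> v; apply: max_card.
have [m fix_m] := bp_fixpoint_exists z_gt0 degD.
pose xs := bp_marginal z m; have fxs : fractional_matching xs.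
  exact: (bp_marginal_fractional (@loopGs 0%N) z_gt0 fix_m).
have VE : bethe_free (Gs 0) z xs = bp_value z m.
  exact: (bethe_free_bp_marginal (@loopGs 0%N) z_gt0 fix_m).
pose err k : R := D%:R * (2 * z) * (z * D%:R) * bp_rate z D ^+ k.
have lower x n : fractional_matching x ->
    bethe_free (Gs 0) z x <= (2 ^+ n)^-1 * ln (matching_poly (Gs n) z).
  move=> /(@tower_fractional _ n) [xn fxn xnE].
  by rewrite ler_pdivlMl ?exprn_gt0 // -xnE; apply: matching_poly_ge.
have upper k : exists N, forall n, (N <= n)%N ->
    (2 ^+ n)^-1 * ln (matching_poly (Gs n) z) <= bethe_free (Gs 0) z xs + err k.
  have [N hN] := girthGs k.+1; exists N => n /hN acyc.
  have [mn fix_mn mnE] := tower_bp_value n fix_m.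
  have := ln_matching_poly_le (@loopGs n) z_gt0 (@tower_degree D n degD) acyc fix_mn (ltnSn k).
  have [_ ->] := tower_card n; rewrite mnE -VE ler_pdivrMl ?exprn_gt0 // => /le_trans; apply.
  by rewrite natrM natrX /err -/D le_eqVlt; apply/orP; left; apply/eqP; ring.
have small eps : 0 < eps -> exists N, forall n, (N <= n)%N ->
    (2 ^+ n)^-1 * ln (matching_poly (Gs n) z) < bethe_free (Gs 0) z xs + eps.
  move=> eps0; have [K hK] := geometric_lt (D%:R * (2 * z) * (z * D%:R))
    (bp_rate_ge0 D z_gt0) (bp_rate_lt1 D z_gt0) eps0.
  have [N hN] := upper K; exists N => n /hN /le_lt_trans; apply.
  by rewrite ltrD2l hK.
exists xs => //; split=> [x fx|].
  (* A better [x] would, through the lower bound in a high lift, exceed the upper bound attached to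
     [xs]. *)
  rewrite leNgt; apply/negP => lt_xs.
  have [N hN] := small _ (etrans (subr_gt0 _ _) lt_xs).
  have := hN N (leqnn N); have := lower x N fx; rewrite addrC subrK => h1 h2.
  by have := le_lt_trans h1 h2; rewrite ltxx.
have nvE n : (nverts (Gs n))%:R^-1 * ln (matching_poly (Gs n) z)
    = (nverts (Gs 0))%:R^-1 * ((2 ^+ n)^-1 * ln (matching_poly (Gs n) z)) :> R.
  by have [-> _] := tower_card n; rewrite natrM natrX invfM mulrAC mulrA mulrC -mulrA; ring.
rewrite (eq_cvg _ _ nvE); apply: cvgMr.
apply/cvgrPdist_lt => eps /small [N hN]; exists N => // n /= /hN h.
rewrite distrC ger0_norm ?subr_ge0 ?lower // ltrBlDl //.
Qed.

End LiftTower.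

Theorem theorem2p1 (R : realType) (G : mgraph) :
  connected_graph G -> bipartite G ->
  (forall z : R, 0 < z -> forall x, in_matching_polytope G x ->
     bethe_free G z x <= ln (matching_poly G z))
  /\
  (forall k : nat, (k <= nu G)%N -> forall x : gE G -> R,
     in_matching_polytope_k G k x ->
     binom_pmf (nu G) k (k%:R / (nu G)%:R) * expR (bethe_entropy G x)
       <= (mcount G k)%:R)
  /\
  (exists Gs : nat -> mgraph,
     [/\ Gs 0%N = G,
         forall n, bipartite (Gs n),
         forall n, is_2lift (Gs n) (Gs n.+1)
       & forall z : R, 0 < z ->
           exists2 xs : gE G -> R, in_matching_polytope G xs &
             (forall x, in_matching_polytope G x -> bethe_free G z x <= bethe_free G z xs) /\
             ((fun n => ((nverts (Gs n))%:R)^-1 * ln (matching_poly (Gs n) z))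
                @ \oo --> (((nverts G)%:R)^-1 * bethe_free G z xs : R))]).
Proof.
move=> _ bipG; split=> [z z0 x xM|].
  by apply: matching_poly_ge => //; apply: in_hull_fractional xM.
split=> [k kn x xk|]; first exact: mcount_ge.
(* The tower is built before [z] is given, so one sequence serves all [z]. *)
have [Gs [G0 bipGs liftGs girthGs]] := large_girth_lifts bipG.
exists Gs; split=> // z z0; subst G.
have [xs fxs [xs_max xs_lim]] := tower_limit bipGs liftGs z0 girthGs.
exists xs; first exact: fractional_matching_in_hull.
by split=> // x xM; apply: xs_max; apply: in_hull_fractional xM.
Qed.
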